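(* Let $d>0$, let $N$ be a positive integer, and let $w$ be a weight function on $\mathcal{D}_d$ satisfying Assumptions (W1)–(W3) of the context. Let $\alpha_N>0$ be a real number and let $\mu_N\in\mathcal{M}(\mathbf{R},2(N+1))$ be a measure with $\operatorname{supp}\mu_N=[-\alpha_N,\alpha_N]$. Suppose there exists a real constant $K_N$ such that $$V_{\mathcal{D}_d}^{\mu_N}(x)+\log w(x)=-K_N\quad\text{for q.e. }x\in[-\alpha_N,\alpha_N],$$ $$V_{\mathcal{D}_d}^{\mu_N}(x)+\log w(x)\le -K_N\quad\text{for every }x\in\mathbf{R}\setminus[-\alpha_N,\alpha_N].$$ Then $(\alpha_N,\mu_N)$ is a solution of the optimization problem $$\inf_{(\alpha,\mu)}\ \sup_{x\in\mathbf{R}}\left(V_{\mathcal{D}_d}^{\mu}(x)+\log w(x)\right),$$ where the infimum is over all pairs of a real number $\alpha>0$ and a measure $\mu\in\mathcal{M}(\mathbf{R},2(N+1))$ with $\operatorname{supp}\mu=[-\alpha,\alpha]$; that is, the infimum is attained at $(\alpha_N,\mu_N)$.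
   Context: $\mathcal{D}_d=\{z\in\mathbf{C}: |\operatorname{Im}z|<d\}$. $B(\mathcal{D}_d)$ is the set of functions $\zeta$ analytic in $\mathcal{D}_d$ with $\lim_{x\to\pm\infty}\int_{-d}^{d}|\zeta(x+\mathrm{i}y)|\,dy=0$ and $\lim_{y\to d-0}\int_{-\infty}^{\infty}(|\zeta(x+\mathrm{i}y)|+|\zeta(x-\mathrm{i}y)|)\,dx<\infty$. Assumptions on $w:\mathcal{D}_d\to\mathbf{C}$: (W1) $w\in B(\mathcal{D}_d)$, $w$ has no zero in $\mathcal{D}_d$, and $w$ takes positive real values on $\mathbf{R}$; (W2) $w$ is even on $\mathbf{R}$; (W3) $\log w$ is concave on $\mathbf{R}$. For $M>0$, $\mathcal{M}(\mathbf{R},M)$ is the set of positive Borel measures $\mu$ on $\mathbf{R}$ with $\mu(\mathbf{R})=M$. For $\mu\in\mathcal{M}(\mathbf{R},M)$ with compact support, $$V_{\mathcal{D}_d}^{\mu}(x)=\int_{\mathbf{R}}\log\left|\tanh\left(\frac{\pi}{4d}(x-z)\right)\right|d\mu(z)\in[-\infty,0].$$ A property holds quasi everywhere (q.e.) on a set $S$ if the set of points of $S$ where it fails has logarithmic capacity zero. *)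

(* Defs.v *)
From HB Require Import structures.
From mathcomp Require Import all_boot all_order all_algebra.
From mathcomp Require Import complex.
From mathcomp Require Import all_classical all_reals all_analysis.

Set Implicit Arguments.
Unset Strict Implicit.
Unset Printing Implicit Defensive.

Import Order.TTheory GRing.Theory Num.Theory.
Import numFieldNormedType.Exports.

Local Open Scope classical_set_scope.
Local Open Scope complex_scope.
Local Open Scope ring_scope.

Section WeightFunctions.
Context {R : realType}.
Implicit Types (d : R) (f w : R[i] -> R[i]).

Definition strip d : set R[i] := [set z | `|complex.Im z| < d].

Definition cmod (z : R[i]) : R := ComplexField.Normc.normc z.

(* [R[i]^o] is the field of complex numbers seen as a normed space over itself,
   so that [derivable] is complex differentiability. *)
Definition analytic_on (A : set R[i]) f :=
  forall z, A z -> derivable (f : R[i]^o -> R[i]^o) z 1.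

(* The integrals are extended-real valued; asking for a real limit [l] says that
   the limit exists and is finite. *)
Definition B_space d : set (R[i] -> R[i]) := [set f |
  [/\ analytic_on (strip d) f,
      (fun x : R => \int[lebesgue_measure]_(y in `](- d)%R, d[)
          (cmod (f (x +i* y)))%:E)%E @ +oo --> 0%E,
      (fun x : R => \int[lebesgue_measure]_(y in `](- d)%R, d[)
          (cmod (f (x +i* y)))%:E)%E @ -oo --> 0%E &
      exists l : R,
        (fun y : R => \int[lebesgue_measure]_(x in [set: R])
           (cmod (f ((x : R) +i* y)) + cmod (f ((x : R) -i* y)))%:E)%E
          @ d^'- --> l%:E]].

(* [log w] on the real line, where [w] is real and positive. *)
Definition logw w (x : R) : R := ln (complex.Re (w x%:C)).

(* [0 < z] in [R[i]] means that [z] is real and positive. *)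
Definition assumption_W1 d w :=
  [/\ B_space d w,
      (forall z, strip d z -> w z != 0) &
      (forall x : R, 0 < w x%:C)].

Definition assumption_W2 w := forall x : R, w (- x)%:C = w x%:C.

(* Concavity of [log w] is convexity of its opposite. *)
Definition assumption_W3 w :=
  convex_function [set: R] (fun x => - logw w x).

Definition weight_function d w :=
  [/\ assumption_W1 d w, assumption_W2 w & assumption_W3 w].

End WeightFunctions.

Section Potentials.
Context {R : realType}.
Local Open Scope ereal_scope.

Definition tanh (x : R) : R :=
  ((expR x - expR (- x)) / (expR x + expR (- x)))%R.

Definition measure_support (mu : {measure set (measurableTypeR R) -> \bar R}) :
    set R :=
  [set x | forall U : set R, open U -> U x -> 0 < mu U].

(* [lne 0 = -oo], so the kernel is [-oo] on the diagonal. *)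
Definition potential (d : R) (mu : {measure set (measurableTypeR R) -> \bar R})
    (x : R) : \bar R :=
  \int[mu]_z lne (`|tanh (pi / (4 * d) * (x - z))|%R)%:E.

Definition log_energy (nu : probability (measurableTypeR R) R) : \bar R :=
  \int[nu]_x \int[nu]_y (- lne (`|x - y|%R)%:E).

(* Logarithmic capacity [exp (- inf I(nu))] of a compact set [K], [nu] ranging
   over the probability measures on [K]; it is [0] when [K] is empty. Measures
   on a subset of the real line do not change when it is seen in the complex
   plane, so this is the planar logarithmic capacity. *)
Definition compact_capacity (K : set R) : \bar R :=
  expeR (- ereal_inf [set log_energy nu |
                       nu in [set nu : probability (measurableTypeR R) R | nu K = 1]]).

Definition log_capacity (E : set R) : \bar R :=
  ereal_sup [set compact_capacity K | K in [set K | compact K /\ K `<=` E]].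

Definition quasi_everywhere (S : set R) (P : R -> Prop) :=
  log_capacity [set x | S x /\ ~ P x] = 0.

Definition admissible (M : R)
    (p : R * {measure set (measurableTypeR R) -> \bar R}) :=
  [/\ (0 < p.1)%R, p.2 [set: R] = M%:E &
      measure_support p.2 = `[(- p.1)%R, p.1]%classic].

Definition objective (d : R) (w : R[i] -> R[i])
    (mu : {measure set (measurableTypeR R) -> \bar R}) : \bar R :=
  ereal_sup [set potential d mu x + (logw w x)%:E | x in [set: R]].

Definition optimal_value (d : R) (w : R[i] -> R[i]) (M : R) : \bar R :=
  ereal_inf [set objective d w p.2 | p in [set p | admissible M p]].

Definition is_solution (d : R) (w : R[i] -> R[i]) (M : R)
    (p : R * {measure set (measurableTypeR R) -> \bar R}) :=
  admissible M p /\ objective d w p.2 = optimal_value d w M.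

End Potentials.

(* Main.v *)
Require Import Defs.
From HB Require Import structures.
From mathcomp Require Import all_boot all_order all_algebra.
From mathcomp Require Import complex.
From mathcomp Require Import all_classical all_reals all_analysis.
From mathcomp Require Import measurable_realfun.
From mathcomp Require Import ring lra.
Set Implicit Arguments.
Unset Strict Implicit.
Unset Printing Implicit Defensive.

Import Order.TTheory GRing.Theory Num.Theory.
Import numFieldNormedType.Exports.
Local Open Scope classical_set_scope.
Local Open Scope ring_scope.

(** Let [U] be minus the potential, that is, the potential of the positive kernel
    [- ln |tanh|]. The equilibrium conditions amount to [U >= K + log w]
    everywhere for [muN], with equality on the interval: a failure of one
    inequality spreads to an interval by lower semicontinuity, and a failure of
    the other lives on a Lebesgue-null set, hence disappears by averaging, because
    compact sets of capacity zero are Lebesgue-null. So the objective at [muN] is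
    at most [- K]. If another [mu] had a smaller objective, its [U] would exceed
    that of [muN] by some [eps > 0] on that interval. Integrating this
    against the equilibrium distribution of the interval, whose potential is
    constant there and smaller outside, contradicts the equality of the masses.
    The existence of that distribution is avoided by smoothing the kernel and
    discretising the interval: on a grid, convexity and monotonicity of the
    kernel yield nonnegative weights with constant potential at the nodes. *)

(** * The kernel [- ln |tanh|]: monotonicity, convexity, growth near 0 *)

Section Kernel.
Context {R : realType}.
Implicit Types (c s t h x y : R).

(** The real profile of the kernel, meaningful for positive arguments; at [t = 0] it takes a default
    value, whereas [green] is [+oo] there. *)
Definition logcoth c t : R := - ln (tanh (c * t)).

Definition green c t : \bar R := (- lne (`|tanh (c * t)|)%:E)%E.

(** With the single exponential [q = expR (- (2 * x))], inequalities about [tanh] become rational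
    inequalities in [q]. *)
Lemma tanhE x :
  tanh x = (1 - expR (- (2 * x))) / (1 + expR (- (2 * x))) :> R.
Proof.
have e0 := expR_gt0 x; have e1 := expR_gt0 (- x); have e2 := expR_gt0 (- (2 * x)).
have E : expR (- (2 * x)) = expR (- x) * expR (- x).
  by rewrite -expRD; congr expR; ring.
have F : expR x * expR (- x) = 1 by rewrite -expRD subrr expR0.
have d1 : expR x + expR (- x) != 0 by rewrite gt_eqF ?addr_gt0.
have d2 : 1 + expR (- (2 * x)) != 0 by rewrite gt_eqF ?addr_gt0.
rewrite /tanh; apply/eqP; rewrite eqr_div// E -subr_eq0; set a := expR x in F *; set b := expR (- x) in F *.
have -> : (a - b) * (1 + b * b) - (1 - b * b) * (a + b) = 2 * b * (a * b - 1) by ring.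
by rewrite F subrr mulr0.
Qed.

Lemma tanhN x : tanh (- x) = - tanh x :> R.
Proof. by rewrite /tanh opprK -mulNr opprB [expR (- x) + expR x]addrC. Qed.

Lemma tanh0 : tanh 0 = 0 :> R.
Proof. by rewrite /tanh oppr0 subrr mul0r. Qed.

Lemma tanh_bounds x : 0 < x -> 0 < tanh x < 1.
Proof.
move=> x0; have e2 := expR_gt0 (- (2 * x)).
have e3 : expR (- (2 * x)) < 1 by rewrite expR_lt1; lra.
rewrite tanhE; set q := expR _ in e2 e3 *.
by rewrite divr_gt0 ?ltr_pdivrMr /=; lra.
Qed.

Lemma tanh_lt x y : x < y -> tanh x < tanh y.
Proof.
move=> xy; have ex := expR_gt0 (- (2 * x)); have ey := expR_gt0 (- (2 * y)).
have : expR (- (2 * y)) < expR (- (2 * x)) by rewrite ltr_expR; lra.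
rewrite !tanhE ltr_pdivrMr; last lra.
rewrite mulrAC ltr_pdivlMr; last lra.
nra.
Qed.

Lemma tanh_le_mul2 x : 0 <= x -> tanh x <= 2 * x.
Proof.
move=> x0; have e2 := expR_gt0 (- (2 * x)).
have := expR_ge1Dx (- (2 * x)).
rewrite tanhE ler_pdivrMr; last lra.
nra.
Qed.

(** With [p], [q] the exponentials of [- 2 x], [- 2 y], the difference is
    [2 (p - q) / ((1 + p) (1 + q))], and [p - q <= 2 (y - x)]. The constant is not sharp. *)
Lemma tanhB_le x y : 0 <= x -> x <= y -> tanh y - tanh x <= 4 * (y - x).
Proof.
move=> x0 xy.
have ex := expR_gt0 (- (2 * x)); have ey := expR_gt0 (- (2 * y)).
have ex1 : expR (- (2 * x)) <= 1 by rewrite expR_le1; lra.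
have E : expR (- (2 * y)) = expR (- (2 * x)) * expR (- (2 * (y - x))).
  by rewrite -expRD; congr expR; ring.
have F := expR_ge1Dx (- (2 * (y - x))).
rewrite !tanhE; move: ex ey ex1 E F.
set p := expR (- (2 * x)); set q := expR (- (2 * y)); set r := expR _.
move=> p0 q0 p1 E F.
have -> : (1 - q) / (1 + q) - (1 - p) / (1 + p) =
          2 * (p - q) / ((1 + p) * (1 + q)) by field; rewrite !gt_eqF//; lra.
rewrite ler_pdivrMr; last by rewrite mulr_gt0//; lra.
have : p - q <= 2 * (y - x) by rewrite E; nra.
move=> pq; apply: (@le_trans _ _ (4 * (y - x))); first lra.
by rewrite ler_peMr//; nra.
Qed.

Lemma logcoth_gt0 c t : 0 < c -> 0 < t -> 0 < logcoth c t.
Proof.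
move=> c0 t0; have /tanh_bounds/andP[t1 t2] : 0 < c * t by rewrite mulr_gt0.
by rewrite /logcoth oppr_gt0 ln_lt0// t1 t2.
Qed.

Lemma logcoth_lt c s t : 0 < c -> 0 < s -> s < t -> logcoth c t < logcoth c s.
Proof.
move=> c0 s0 st; have /tanh_bounds/andP[s1 _] : 0 < c * s by rewrite mulr_gt0.
have s2 : tanh (c * s) < tanh (c * t) by rewrite tanh_lt// ltr_pM2l.
by rewrite /logcoth ltrN2 ltr_ln// posrE// (lt_trans s1).
Qed.

Lemma logcoth_le c s t :
  0 < c -> 0 < s -> s <= t -> logcoth c t <= logcoth c s.
Proof.
by move=> c0 s0; rewrite le_eqVlt => /predU1P[->//|/(logcoth_lt c0 s0)/ltW].
Qed.

(** The product of [tanh] at [c (t - h)] and [c (t + h)] has to be below the square of [tanh] at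
    [c t]. In [q], [r] and [i = 1 / r] this is the positivity of [2 q (1 + q^2) (r + i - 2)], that
    is, AM-GM for [r] and its inverse. *)
Lemma logcoth_strictly_convex c t h : 0 < c -> 0 < h -> h < t ->
  2 * logcoth c t < logcoth c (t - h) + logcoth c (t + h).
Proof.
move=> c0 h0 ht.
have P s : 0 < s -> 0 < tanh (c * s).
  by move=> s0; have /tanh_bounds/andP[] : 0 < c * s by rewrite mulr_gt0.
have P0 : 0 < t by lra.
have P1 : 0 < t - h by lra.
have P2 : 0 < t + h by lra.
have Q0 := P _ P0; have Q1 := P _ P1; have Q2 := P _ P2.
have Q3 := mulr_gt0 Q0 Q0; have Q4 := mulr_gt0 Q1 Q2.
rewrite /logcoth mulrN -opprD ltrN2 mulr_natl mulr2n -!lnM ?posrE//.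
rewrite ltr_ln ?posrE// !tanhE.
have q0 := expR_gt0 (- (2 * (c * t))).
have r0 := expR_gt0 (2 * (c * h)); have i0 := expR_gt0 (- (2 * (c * h))).
have r1 : 1 < expR (2 * (c * h)) by rewrite expR_gt1 !mulr_gt0.
have ri : expR (2 * (c * h)) * expR (- (2 * (c * h))) = 1.
  by rewrite -expRD subrr expR0.
have -> : expR (- (2 * (c * (t - h)))) =
          expR (- (2 * (c * t))) * expR (2 * (c * h)).
  by rewrite -expRD; congr expR; ring.
have -> : expR (- (2 * (c * (t + h)))) =
          expR (- (2 * (c * t))) * expR (- (2 * (c * h))).
  by rewrite -expRD; congr expR; ring.
move: q0 r0 i0 r1 ri; set q := expR (- (2 * (c * t))).
set r := expR (2 * _); set i := expR (- (2 * (c * h))) => q0 r0 i0 r1 ri.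
have qr := mulr_gt0 q0 r0; have qi := mulr_gt0 q0 i0.
rewrite !mulf_div ltr_pdivrMr; last by rewrite mulr_gt0//; lra.
rewrite mulrAC ltr_pdivlMr; last by rewrite mulr_gt0//; lra.
have p2 : 2 < r + i.
  have : 0 < (r - 1) ^+ 2 by rewrite exprn_gt0//; lra.
  have : (r - 1) ^+ 2 * i = r + i - 2.
    have -> : (r - 1) ^+ 2 * i = r * (r * i) - 2 * (r * i) + i by ring.
    by rewrite ri; ring.
  by move=> E /mulr_gt0 /(_ i0); rewrite E subr_gt0.
rewrite -subr_gt0.
set lhs := (X in 0 < X).
have -> : lhs = 2 * q * (1 + q ^+ 2) * (r + i - 2) - 4 * q ^+ 3 * (r * i - 1).
  by rewrite /lhs; ring.
rewrite ri subrr mulr0 subr0.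
by rewrite mulr_gt0 ?subr_gt0// !mulr_gt0// addr_gt0// exprn_gt0.
Qed.

(** Equivalent to [tanh (2 s) <= 2 tanh s], which in the exponential [q] reduces to
    [0 <= (1 - q)^3]. *)
Lemma logcoth_half c t :
  0 < c -> 0 < t -> logcoth c (t / 2) <= logcoth c t + ln 2.
Proof.
move=> c0 t0.
have P s : 0 < s -> 0 < tanh (c * s).
  by move=> s0; have /tanh_bounds/andP[] : 0 < c * s by rewrite mulr_gt0.
have t20 : 0 < t / 2 by rewrite divr_gt0.
have Q0 := P _ t0; have Q1 := P _ t20.
have Q2 : 0 < tanh (c * (t / 2)) * 2 by exact: mulr_gt0.
rewrite /logcoth lerNl opprD opprK lerBlDr -lnM ?posrE//.
rewrite ler_ln ?posrE// !tanhE.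
have -> : expR (- (2 * (c * t))) = expR (- (2 * (c * (t / 2)))) ^+ 2.
  by rewrite expr2 -expRD; congr expR; field.
have q0 := expR_gt0 (- (2 * (c * (t / 2)))).
have q1 : expR (- (2 * (c * (t / 2)))) < 1 by rewrite expR_lt1; nra.
move: q0 q1; set q := expR _ => q0 q1.
rewrite ler_pdivrMr; last by rewrite addr_gt0// exprn_gt0.
have -> : (1 - q) / (1 + q) * 2 * (1 + q ^+ 2) = (1 - q) * 2 * (1 + q ^+ 2) / (1 + q).
  by field; rewrite gt_eqF//; lra.
rewrite ler_pdivlMr; last lra.
have : 0 <= (1 - q) ^+ 3 by rewrite exprn_ge0//; lra.
nra.
Qed.

(** The bound [ln (1 + x) <= x] turns a difference of logarithms into a relative difference of
    [tanh], whose denominator is at least [tanh (c * e)]. *)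
Lemma logcoth_lipschitz c e : 0 < c -> 0 < e -> exists2 L : R, 0 < L &
  forall s t, e <= s -> e <= t -> `|logcoth c s - logcoth c t| <= L * `|s - t|.
Proof.
move=> c0 e0.
have P s : 0 < s -> 0 < tanh (c * s).
  by move=> s0; have /tanh_bounds/andP[] : 0 < c * s by rewrite mulr_gt0.
exists (4 * c / tanh (c * e)).
  by apply: divr_gt0; [exact: mulr_gt0|exact: P].
move=> s t; wlog st : s t / s <= t.
  move=> H es et; case: (leP s t) => [st|/ltW ts]; first exact: H.
  by rewrite distrC [`|s - t|]distrC; apply: H.
move=> es et; rewrite distrC [in leRHS]distrC.
have s0 : 0 < s by lra.
have t0 : 0 < t by lra.
rewrite ler0_norm ?subr_le0 ?logcoth_le// opprB ger0_norm ?subr_ge0//.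
have P0 := P _ e0; have P1 := P _ s0; have P2 := P _ t0.
have es' : tanh (c * e) <= tanh (c * s).
  by move: es; rewrite le_eqVlt => /predU1P[->//|es]; rewrite ltW// tanh_lt// ltr_pM2l.
rewrite /logcoth opprK [leLHS]addrC -ln_div ?posrE//.
have -> : tanh (c * t) / tanh (c * s) = 1 + (tanh (c * t) - tanh (c * s)) / tanh (c * s).
  by field; rewrite !gt_eqF//; lra.
apply: (@le_trans _ _ ((tanh (c * t) - tanh (c * s)) / tanh (c * s))).
  have : 0 <= (tanh (c * t) - tanh (c * s)) / tanh (c * s).
    rewrite divr_ge0 ?(ltW P1)// subr_ge0.
    by move: st; rewrite le_eqVlt => /predU1P[->//|st]; rewrite ltW// tanh_lt// ltr_pM2l.
  by move=> H; apply: le_ln1Dx; lra.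
have H : tanh (c * t) - tanh (c * s) <= 4 * c * (t - s).
  have := @tanhB_le (c * s) (c * t); rewrite -mulrBr mulrA; apply.
    by rewrite ltW// mulr_gt0.
  by rewrite ler_pM2l.
have -> : 4 * c / tanh (c * e) * (t - s) = 4 * c * (t - s) / tanh (c * e).
  by rewrite mulrAC.
apply: (@le_trans _ _ (4 * c * (t - s) / tanh (c * s))).
  by rewrite ler_pM2r ?invr_gt0.
by rewrite ler_wpM2l ?lef_pV2 ?posrE// mulr_ge0 ?subr_ge0// mulr_ge0// ltW.
Qed.

Lemma logcoth_unbounded c A : 0 < c ->
  exists2 e : R, 0 < e & forall t, 0 < t -> t <= e -> A <= logcoth c t.
Proof.
(* The radius solves [2 * c * t = expR (- A)], in view of [tanh s <= 2 * s]. *)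
move=> c0; exists (expR (- A) / (2 * c)); first by rewrite divr_gt0 ?expR_gt0 ?mulr_gt0.
move=> t t0; rewrite ler_pdivlMr ?mulr_gt0// => H.
have ct0 : 0 < c * t by rewrite mulr_gt0.
have /andP[t1 _] := tanh_bounds ct0.
rewrite /logcoth lerNr -[leRHS]expRK ler_ln ?posrE ?expR_gt0//.
apply: le_trans H; apply: (le_trans (tanh_le_mul2 (ltW ct0))).
by rewrite mulrA mulrC.
Qed.

Lemma green0 c : green c 0 = +oo%E.
Proof. by rewrite /green mulr0 tanh0 normr0 le0_lneNy. Qed.

Lemma greenE c t : 0 < c -> t != 0 -> green c t = (logcoth c `|t|)%:E.
Proof.
move=> c0 t0.
have ct0 : 0 < c * `|t| by rewrite mulr_gt0 ?normr_gt0.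
have /andP[t1 _] := tanh_bounds ct0.
rewrite /green /logcoth.
have -> : `|tanh (c * t)| = tanh (c * `|t|).
  case: (ltrgt0P t) t0 t1 => // _ _ t1; first by rewrite ger0_norm// ltW.
  by rewrite -[t in LHS]opprK mulrN tanhN normrN ger0_norm// ltW.
by rewrite lne_EFin.
Qed.

Lemma green_ge0 c t : 0 < c -> (0 <= green c t)%E.
Proof.
move=> c0; case: (eqVneq t 0) => [->|t0]; first by rewrite green0.
by rewrite greenE// lee_fin ltW// logcoth_gt0// normr_gt0.
Qed.

End Kernel.

(** * Equilibrium weights on a finite grid *)

Section DiscreteEquilibrium.
Context {R : realType}.

(** The exact second-order expansion of the discrete energy along one coordinate; up to a factor 2,
    its slope is the potential at node [i] minus 1. *)
Lemma quadratic_form_shift n (K : 'I_n -> 'I_n -> R) (v : 'I_n -> R) (i : 'I_n)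
    (s : R) (Ksym : forall j k, K j k = K k j) :
  let f u := \sum_j \sum_k u j * u k * K j k - 2 * \sum_j u j in
  f (fun j => v j + s * (j == i)%:R) - f v =
  2 * s * (\sum_j v j * K i j - 1) + s ^+ 2 * K i i.
Proof.
move=> f; rewrite /f.
have E1 : \sum_j (v j + s * (j == i)%:R) = \sum_j v j + s.
  rewrite big_split/=; congr (_ + _).
  rewrite (bigD1 i)//= eqxx mulr1 big1 ?addr0// => j /negbTE->.
  by rewrite mulr0.
have E2 (F : 'I_n -> R) : \sum_j s * (j == i)%:R * F j = s * F i.
  rewrite (bigD1 i)//= eqxx mulr1 big1 ?addr0// => j /negbTE->.
  by rewrite mulr0 mul0r.
have E3 : \sum_j \sum_k (v j + s * (j == i)%:R) * (v k + s * (k == i)%:R) * K j k =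
  \sum_j \sum_k v j * v k * K j k + \sum_j v j * s * K j i + s * \sum_k v k * K i k
   + s * (s * K i i).
  under eq_bigr => j _ do under eq_bigr => k _ do rewrite -mulrA mulrDl.
  under eq_bigr => j _ do rewrite big_split/= -!mulr_sumr.
  rewrite big_split/= E2.
  have -> : \sum_k (v k + s * (k == i)%:R) * K i k = \sum_k v k * K i k + s * K i i.
    by under eq_bigr => k _ do rewrite mulrDl; rewrite big_split/= E2.
  rewrite mulrDr addrA; congr (_ + _ + _).
  rewrite -big_split/=; apply: eq_bigr => j _.
  under eq_bigr => k _ do rewrite mulrDl.
  rewrite big_split/= E2 mulrDr mulr_sumr; congr (_ + _); last by rewrite mulrA.
  by apply: eq_bigr => k _; rewrite mulrA.
rewrite E3 E1.
have -> : \sum_j v j * s * K j i = s * \sum_k v k * K i k.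
  by rewrite mulr_sumr; apply: eq_bigr => j _; rewrite Ksym; ring.
ring.
Qed.

Lemma cvg_sum_ord (T : Type) (F : set_system T) (FF : Filter F) n
    (f : 'I_n -> T -> R) (l : 'I_n -> R) :
  (forall i, f i x @[x --> F] --> l i) ->
  \sum_i f i x @[x --> F] --> \sum_i l i.
Proof.
move=> fl; elim: (index_enum _) => [|i r IHr].
  rewrite big_nil; under eq_cvg do rewrite big_nil.
  exact: cvg_cst.
rewrite big_cons; under eq_cvg do rewrite big_cons.
exact: cvgD (fl i) IHr.
Qed.

Lemma cvg_quadratic (T : Type) (F : set_system T) n (K : 'I_n -> 'I_n -> R)
    (f : 'I_n -> T -> R) (l : 'I_n -> R) : Filter F ->
  (forall i, f i x @[x --> F] --> l i) ->
  \sum_j \sum_k f j x * f k x * K j k - 2 * \sum_j f j x @[x --> F] -->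
  \sum_j \sum_k l j * l k * K j k - 2 * \sum_j l j.
Proof.
move=> FF fl; apply: cvgB; last by apply: cvgM; [exact: cvg_cst|exact: cvg_sum_ord].
apply: cvg_sum_ord => i; apply: cvg_sum_ord => j.
by apply: cvgM; [exact: cvgM|exact: cvg_cst].
Qed.

(* Minimising the quadratic form on a box gives the complementarity conditions
   of an equilibrium distribution. *)
Lemma exists_complementary_weights n (K : 'I_n -> 'I_n -> R)
    (K_gt0 : forall i j, 0 < K i j) (Ksym : forall i j, K i j = K j i) :
  exists v : 'I_n -> R, [/\ forall i, 0 <= v i,
    forall i, 1 <= \sum_j v j * K i j &
    forall i, 0 < v i -> \sum_j v j * K i j = 1].
Proof.
(* The box is large enough to keep its upper faces inactive: a coordinate equal to [B] alone makes
   the potential at its node exceed 1. *)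
pose B := 1 + \sum_i (K i i)^-1.
have Ki i : 0 <= (K i i)^-1 by rewrite invr_ge0 ltW.
have B0 : 0 < B.
  have : 0 <= \sum_i (K i i)^-1 by apply: sumr_ge0 => i _; exact: Ki.
  by rewrite /B; lra.
have BK i : 1 < K i i * B.
  rewrite mulrDr mulr1 (bigD1 i)//= mulrDr divff ?gt_eqF//.
  set S := \sum_(_ | _) _.
  have : 0 <= K i i * S.
    by apply: mulr_ge0; [exact: ltW|apply: sumr_ge0 => j _; exact: Ki].
  by have := K_gt0 i i; lra.
pose g (u : 'I_n -> R) := \sum_j \sum_k u j * u k * K j k - 2 * \sum_j u j.
pose f (u : 'rV[R]_n) := g (u ord0).
pose box := [set u : 'rV[R]_n | forall i, `[0, B]%classic (u ord0 i)].
have cbox : compact box by apply: (@rV_compact _ n (fun=> `[0, B]%classic)) => i; exact: segment_compact.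
have [||u bu fmin] := @compact_EVT_min _ _ f box _ cbox.
- by exists 0 => i /=; rewrite mxE in_itv/= lexx ltW.
- apply: continuous_subspaceT => u.
  have FF : Filter (nbhs u) := nbhs_filter u.
  have X i : v ord0 i @[v --> u] --> u ord0 i by exact: coord_continuous.
  exact: (@cvg_quadratic 'rV[R]_n (nbhs u) n K (fun i v => v ord0 i) (fun i => u ord0 i) FF X).
rewrite inE in bu.
pose v := u ord0.
have v0 i : 0 <= v i by have := bu i; rewrite /= in_itv/= => /andP[].
have vB i : v i <= B by have := bu i; rewrite /= in_itv/= => /andP[].
(* Minimality tested against displacements along one coordinate inside the box. *)
have step i s : 0 <= v i + s <= B ->
    0 <= 2 * s * (\sum_j v j * K i j - 1) + s ^+ 2 * K i i.
  move=> sB; rewrite -(quadratic_form_shift _ _ _ Ksym) subr_ge0.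
  pose u' : 'rV[R]_n := \row_j (v j + s * (j == i)%:R).
  have := fmin u'; rewrite /f /g.
  have -> : u' ord0 = fun j => v j + s * (j == i)%:R.
    by apply/funext => j; rewrite mxE.
  apply; rewrite inE => j /=; rewrite mxE in_itv/=.
  by case: eqVneq => [->|_]; rewrite ?mulr1// mulr0 addr0 v0 vB.
have K0 i := K_gt0 i i.
have ge1 i : 1 <= \sum_j v j * K i j.
  rewrite leNgt; apply/negP => lt1.
  have viB : v i < B.
    rewrite ltNge; apply/negP => Bv; move: lt1; apply/negP; rewrite -leNgt.
    rewrite (bigD1 i)//=; apply: (@le_trans _ _ (v i * K i i)).
      have : K i i * B <= K i i * v i by rewrite ler_pM2l.
      by have := BK i; lra.
    by rewrite lerDl sumr_ge0// => j _; rewrite mulr_ge0// ltW.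
  pose e := 1 - \sum_j v j * K i j.
  (* The displacement stays in the box, and its quadratic term is at most half of the linear gain
     [2 * s * e]. *)
  pose s := Num.min (B - v i) (e / K i i).
  have e0 : 0 < e by rewrite subr_gt0.
  have s0 : 0 < s by rewrite lt_min subr_gt0 viB divr_gt0.
  have sB : s <= B - v i by rewrite ge_min lexx.
  have se : s * K i i <= e by rewrite -ler_pdivlMr// ge_min lexx orbT.
  have := step i s; rewrite addr_ge0 ?(ltW s0)//= -lerBrDl => /(_ sB).
  by rewrite -/e -(opprB 1) -/e; nra.
exists v; split => // i vi0.
apply/eqP; rewrite eq_le ge1 andbT.
rewrite leNgt; apply/negP => lt1.
pose e := \sum_j v j * K i j - 1.
pose s := Num.min (v i) (e / K i i).
have e0 : 0 < e by rewrite subr_gt0.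
have s0 : 0 < s by rewrite lt_min vi0 divr_gt0.
have sB : s <= v i by rewrite ge_min lexx.
have se : s * K i i <= e by rewrite -ler_pdivlMr// ge_min lexx orbT.
have := step i (- s); rewrite subr_ge0 sB/=.
have -> : v i - s <= B by rewrite (le_trans _ (vB i))// gerBl ltW.
by move=> /(_ isT); rewrite -/e; nra.
Qed.
(* A weight vanishing at a node makes the potential strictly convex there, so
   the potential cannot be maximal at that node. *)
Lemma grid_equilibrium n (K : R -> R) (h : R) (h_gt0 : 0 < h)
    (K_gt0 : forall t, 0 < K t) (K_even : forall t, K (- t) = K t)
    (K_dec : forall s t, 0 <= s -> s <= t -> K t <= K s)
    (K_conv : forall t, h <= t -> 2 * K t < K (t - h) + K (t + h)) :
  exists v : 'I_n.+1 -> R, (forall i, 0 <= v i) /\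
    forall i : 'I_n.+1, \sum_(j < n.+1) v j * K (i%:R * h - j%:R * h) = 1.
Proof.
have [i j||v [v0 ge1 eq1]] :=
    @exists_complementary_weights _ (fun i j : 'I_n.+1 => K (i%:R * h - j%:R * h)).
- exact: K_gt0.
- by move=> i j; rewrite -K_even opprB.
exists v; split => // i.
pose u x := \sum_(j < n.+1) v j * K (x - j%:R * h).
pose f (i : 'I_n.+1) := u (i%:R * h).
pose m := [arg max_(k > i) f k]%O.
have fm k : f k <= f m.
  by rewrite /m; case: Order.TotalTheory.arg_maxP => // k0 _; exact.
suff fm1 : f m <= 1.
  apply/eqP; rewrite eq_le; apply/andP; split; last exact: ge1.
  exact: le_trans (fm i) fm1.
have [vm0|vm0] := ltP 0 (v m); first by rewrite /f /u eq1.
have {vm0}vm : v m = 0 by apply/eqP; rewrite eq_le vm0 v0.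
exfalso.
have K_mono s t : `|s| <= `|t| -> K t <= K s.
  have Kabs x : K `|x| = K x.
    by case: (ger0P x) => // _; rewrite K_even.
  by move=> st; rewrite -Kabs -[leRHS]Kabs; exact: K_dec.
(* At an end node the neighbouring point may be off the grid; it is then farther from every node, so
   the potential does not increase. *)
have left_le : u (m%:R * h - h) <= f m.
  case: (posnP m) => m0; last first.
    have mn : (m.-1 < n.+1)%N by rewrite (leq_ltn_trans (leq_pred _)).
    have := fm (Ordinal mn); rewrite /f /=.
    have E : m%:R = m.-1%:R + 1 :> R by rewrite natr1 prednK.
    by rewrite E mulrDl mul1r addrK.
  rewrite /f /u m0 mul0r; apply: ler_sum => j _; rewrite ler_wpM2l//.
  have j0 : 0 <= j%:R * h by rewrite mulr_ge0// ltW.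
  by apply: K_mono; rewrite !ler0_norm; lra.
have right_le : u (m%:R * h + h) <= f m.
  case: (ltnP m n) => mn; last first.
    rewrite /f /u; apply: ler_sum => j _; rewrite ler_wpM2l//.
    have jm : 0 <= m%:R * h - j%:R * h.
      rewrite -mulrBl mulr_ge0 ?(ltW h_gt0)// subr_ge0 ler_nat.
      by rewrite (leq_trans _ mn)// -ltnS.
    by apply: K_mono; rewrite !ger0_norm; lra.
  have mn' : (m.+1 < n.+1)%N by [].
  by have := fm (Ordinal mn'); rewrite /f /= -natr1 mulrDl mul1r.
(* Some weight is positive, since the potential is at least 1; its node differs from [m] and makes
   the summed convexity inequality strict. *)
have [j vj] : exists j, 0 < v j.
  apply: contrapT => /forallNP nv; have := ge1 ord0.
  rewrite big1 ?ler10// => j _.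
  have -> : v j = 0; last by rewrite mul0r.
  by apply/eqP; rewrite eq_le v0 andbT leNgt; apply/negP/nv.
have : 2 * f m < u (m%:R * h - h) + u (m%:R * h + h); last by lra.
(* Convexity is available only at distance at least [h], hence the exclusion of [m], whose weight
   vanishes. Evenness handles the nodes to the right of [m]. *)
have conv (k : 'I_n.+1) : k != m ->
    2 * K (m%:R * h - k%:R * h) <
    K (m%:R * h - h - k%:R * h) + K (m%:R * h + h - k%:R * h).
  have [|km _|/val_inj->] := ltngtP k m; last by rewrite eqxx.
  - move=> km _.
    have := K_conv (m%:R * h - k%:R * h); rewrite [_ - h - _]addrAC [_ + h - _]addrAC.
    apply; rewrite -mulrBl -[leLHS]mul1r ler_pM2r// -natrB 1?ltnW// ler1n subn_gt0//.
  - have := K_conv (k%:R * h - m%:R * h).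
    rewrite -(K_even (m%:R * h - k%:R * h)) opprB.
    rewrite -(K_even (m%:R * h - h - k%:R * h)) -(K_even (m%:R * h + h - k%:R * h)).
    have -> : - (m%:R * h - h - k%:R * h) = k%:R * h - m%:R * h + h by ring.
    have -> : - (m%:R * h + h - k%:R * h) = k%:R * h - m%:R * h - h by ring.
    rewrite [K _ + K _]addrC; apply.
    by rewrite -mulrBl -[leLHS]mul1r ler_pM2r// -natrB 1?ltnW// ler1n subn_gt0.
have jm : j != m by apply: contraTneq vj => ->; rewrite vm ltxx.
rewrite /f /u mulr_sumr -big_split/=.
rewrite (bigD1 j)//= [ltRHS](bigD1 j)//=; apply: ltr_leD.
  by rewrite mulrCA -mulrDr ltr_pM2l// conv.
apply: ler_sum => k _; rewrite mulrCA -mulrDr.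
have [->|km] := eqVneq k m; first by rewrite vm !mul0r.
by rewrite ler_wpM2l// ltW// conv.
Qed.

End DiscreteEquilibrium.

(** * A bounded Lipschitz regularisation of the kernel *)

Section SmoothedKernel.
Context {R : realType}.
Implicit Types (c e t h x : R).

Lemma near_invS_le e : 0 < e -> \forall n \near \oo, n.+1%:R^-1 <= e.
Proof.
move=> e0; have := near_infty_natSinv_lt (PosNum e0).
by apply: filterS => n /ltW.
Qed.

(** Shifting [|t|] by [e] removes the singularity and, unlike truncation, keeps the strict convexity
    required on a grid. The kernel increases to [green] as [e] decreases to 0. *)
Definition smooth_green c e t : R := logcoth c (`|t| + e).

Lemma smooth_green_gt0 c e t : 0 < c -> 0 < e -> 0 < smooth_green c e t.
Proof. by move=> c0 e0; apply: logcoth_gt0 => //; rewrite ltr_wpDl. Qed.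

Lemma smooth_greenN c e t : smooth_green c e (- t) = smooth_green c e t.
Proof. by rewrite /smooth_green normrN. Qed.

Lemma smooth_green_le c e s t : 0 < c -> 0 < e -> 0 <= s -> s <= t ->
  smooth_green c e t <= smooth_green c e s.
Proof.
move=> c0 e0 s0 st; have t0 : 0 <= t by exact: le_trans st.
by apply: logcoth_le; rewrite ?ltr_wpDl// !ger0_norm// lerD2r.
Qed.

Lemma smooth_green_max c e t : 0 < c -> 0 < e ->
  smooth_green c e t <= logcoth c e.
Proof. by move=> c0 e0; apply: logcoth_le; rewrite // lerDr. Qed.

Lemma smooth_green_convex c e h t : 0 < c -> 0 < e -> 0 < h -> h <= t ->
  2 * smooth_green c e t < smooth_green c e (t - h) + smooth_green c e (t + h).
Proof.
move=> c0 e0 h0 ht; rewrite /smooth_green !ger0_norm ?subr_ge0//; [|lra..].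
rewrite [t - h + e]addrAC [t + h + e]addrAC.
by apply: logcoth_strictly_convex => //; lra.
Qed.

Lemma smooth_green_lipschitz c e : 0 < c -> 0 < e -> exists2 L : R, 0 < L &
  forall s t, `|smooth_green c e s - smooth_green c e t| <= L * `|s - t|.
Proof.
move=> c0 e0; have [L L0 HL] := logcoth_lipschitz c0 e0; exists L => // s t.
rewrite /smooth_green; apply: (le_trans (HL _ _ _ _)); rewrite ?lerDr//.
rewrite ler_pM2l//.
have -> : `|s| + e - (`|t| + e) = `|s| - `|t| by ring.
exact: ler_dist_dist.
Qed.

Lemma lipschitz_continuous (f : R -> R) L : 0 < L ->
  (forall s t, `|f s - f t| <= L * `|s - t|) -> continuous f.
Proof.
move=> L0 fL x; apply/cvgrPdist_lt => eps eps0; near=> y.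
apply: (le_lt_trans (fL x y)); rewrite mulrC -ltr_pdivlMr//.
near: y; apply: (@nbhsx_ballx _ R^o); exact: divr_gt0.
Unshelve. all: by end_near. Qed.

Lemma smooth_green_continuous c e : 0 < c -> 0 < e -> continuous (smooth_green c e).
Proof.
move=> c0 e0; have [L L0] := smooth_green_lipschitz c0 e0.
exact: lipschitz_continuous.
Qed.

Lemma measurable_smooth_green c e : 0 < c -> 0 < e ->
  measurable_fun [set: R] (smooth_green c e).
Proof.
by move=> c0 e0; apply: continuous_measurable_fun; exact: smooth_green_continuous.
Qed.

Lemma smooth_green_le_green c e t : 0 < c -> 0 < e ->
  ((smooth_green c e t)%:E <= green c t)%E.
Proof.
move=> c0 e0; case: (eqVneq t 0) => [->|t0]; first by rewrite green0 leey.
by rewrite greenE// lee_fin logcoth_le// ?normr_gt0// lerDl ltW.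
Qed.

Lemma smooth_green_nondecreasing c t : 0 < c ->
  nondecreasing_seq (fun n => smooth_green c n.+1%:R^-1 t).
Proof.
move=> c0 m n mn; rewrite /smooth_green; apply: logcoth_le => //.
by rewrite lerD2l lef_pV2 ?posrE ?ltr0n// ler_nat.
Qed.

Lemma smooth_green_cvg c t : 0 < c ->
  (smooth_green c n.+1%:R^-1 t)%:E @[n --> \oo] --> green c t.
Proof.
move=> c0; case: (eqVneq t 0) => [->|t0].
  rewrite green0; apply/cvgeyPge => A.
  have [e e0 He] := logcoth_unbounded A c0.
  near=> n; rewrite lee_fin /smooth_green normr0 add0r; apply: He.
    by rewrite invr_gt0 ltr0n.
  near: n; exact: near_invS_le.
rewrite greenE//; apply: cvg_EFin; first exact: nearW.
have nt0 : 0 < `|t| by rewrite normr_gt0.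
have [L L0 HL] := logcoth_lipschitz c0 nt0.
apply/cvgrPdist_le => eps eps0; near=> n.
apply: (le_trans (HL _ _ _ _)) => //; first by rewrite lerDl invr_ge0 ler0n.
rewrite opprD addNKr normrN ger0_norm ?invr_ge0 ?ler0n// mulrC -ler_pdivlMr//.
near: n; apply: near_invS_le; exact: divr_gt0.
Unshelve. all: by end_near. Qed.

Lemma measurable_green c : 0 < c -> measurable_fun [set: R] (green c).
Proof.
move=> c0; apply: (emeasurable_fun_cvg (fun n t => (smooth_green c n.+1%:R^-1 t)%:E)).
  by move=> n; apply/measurable_EFinP; exact: measurable_smooth_green.
by move=> t _; exact: smooth_green_cvg.
Qed.

Lemma continuous_subr x : continuous (fun z : R => x - z).
Proof.
apply: (@lipschitz_continuous _ 1) => // s t.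
have -> : x - s - (x - t) = t - s by ring.
by rewrite mul1r distrC.
Qed.

Lemma measurable_subr x : measurable_fun [set: R] (fun z : R => x - z).
Proof. by apply: continuous_measurable_fun; exact: continuous_subr. Qed.

End SmoothedKernel.

(** * Potentials of finite measures and their smoothings *)

Section GreenPotential.
Context {R : realType}.
Variable c : R.
Hypothesis c_gt0 : 0 < c.

Definition green_potential (mu : {measure set (measurableTypeR R) -> \bar R})
    (x : R) : \bar R := (\int[mu]_z green c (x - z))%E.

(** For positive [e] and a measure of finite mass, [fine] loses nothing, since the smoothed kernel
    is bounded. *)
Definition smooth_potential (e : R)
    (mu : {measure set (measurableTypeR R) -> \bar R}) (x : R) : R :=
  fine (\int[mu]_z (smooth_green c e (x - z))%:E)%E.

Lemma measurable_green_shift x :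
  measurable_fun [set: measurableTypeR R] (fun z : R => green c (x - z)).
Proof.
exact: (measurableT_comp (measurable_green c_gt0) (measurable_subr x)).
Qed.

Lemma measurable_smooth_green_shift e x : 0 < e ->
  measurable_fun [set: measurableTypeR R] (fun z : R => smooth_green c e (x - z)).
Proof.
by move=> e0; exact: (measurableT_comp (measurable_smooth_green c_gt0 e0) (measurable_subr x)).
Qed.

Lemma emeasurable_smooth_green_shift e x : 0 < e ->
  measurable_fun [set: measurableTypeR R]
    (fun z : R => (smooth_green c e (x - z))%:E).
Proof.
by move=> e0; apply/measurable_EFinP; exact: measurable_smooth_green_shift.
Qed.

Variables (mu : {measure set (measurableTypeR R) -> \bar R}) (M : R).
Hypothesis mu_mass : mu [set: R] = M%:E.

Lemma mass_ge0 : 0 <= M.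
Proof. by rewrite -lee_fin -mu_mass measure_ge0. Qed.

Lemma integral_le_mass (f : R -> R) B :
  measurable_fun [set: measurableTypeR R] f -> (forall x, 0 <= f x) ->
  (forall x, f x <= B) -> (\int[mu]_z (f z)%:E <= (B * M)%:E)%E.
Proof.
move=> mf f0 fB; rewrite EFinM -mu_mass -integral_cst//.
apply: ge0_le_integral => //.
- by move=> x _; rewrite lee_fin.
- exact/measurable_EFinP.
- by move=> x _; rewrite lee_fin.
Qed.

Lemma integral_fin (f : R -> R) B :
  measurable_fun [set: measurableTypeR R] f -> (forall x, 0 <= f x) ->
  (forall x, f x <= B) -> (\int[mu]_z (f z)%:E)%E \is a fin_num.
Proof.
move=> mf f0 fB; rewrite ge0_fin_numE.
  exact: le_lt_trans (integral_le_mass mf f0 fB) (ltry _).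
by apply: integral_ge0 => x _; rewrite lee_fin.
Qed.

Section Smooth.
Variable e : R.
Hypothesis e_gt0 : 0 < e.

Let s0 t : 0 <= smooth_green c e t. Proof. by rewrite ltW// smooth_green_gt0. Qed.

Lemma smooth_potentialE x :
  (\int[mu]_z (smooth_green c e (x - z))%:E)%E = (smooth_potential e mu x)%:E.
Proof.
rewrite /smooth_potential fineK//; apply: (@integral_fin _ (logcoth c e)) => //.
  exact: measurable_smooth_green_shift.
by move=> z; exact: smooth_green_max.
Qed.

Lemma smooth_potential_lipschitz : exists2 L : R, 0 < L & forall x y,
  `|smooth_potential e mu x - smooth_potential e mu y| <= L * `|x - y|.
Proof.
have [L L0 HL] := smooth_green_lipschitz c_gt0 e_gt0.
have M0 := mass_ge0.
(* [M + 1] keeps the constant positive even for the zero measure. *)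
exists (L * (M + 1)); first by rewrite mulr_gt0// ltr_wpDl.
suff H x y : smooth_potential e mu x <= smooth_potential e mu y + L * `|x - y| * M.
  move=> x y; rewrite mulrAC mulrDr mulr1.
  have := H x y; have := H y x; rewrite (distrC y).
  have : 0 <= L * `|x - y| by rewrite mulr_ge0// ltW.
  by rewrite ler_norml => *; apply/andP; split; lra.
have Lxy : 0 <= L * `|x - y| by rewrite mulr_ge0// ltW.
rewrite -lee_fin EFinD -!smooth_potentialE.
rewrite [X in (_ <= _ + X)%E]EFinM -mu_mass -[X in (_ <= _ + X)%E]integral_cst//.
rewrite -ge0_integralD//; last 2 first.
- by move=> z _; rewrite lee_fin.
- exact: emeasurable_smooth_green_shift.
apply: ge0_le_integral => //.
- by move=> z _; rewrite lee_fin.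
- exact: emeasurable_smooth_green_shift.
- apply: emeasurable_funD => //.
  exact: emeasurable_smooth_green_shift.
move=> z _; rewrite /= -EFinD lee_fin -lerBlDl.
apply: le_trans (ler_norm _) _; apply: le_trans (HL _ _) _.
by have -> : x - z - (y - z) = x - y by ring.
Qed.

Lemma smooth_potential_continuous : continuous (smooth_potential e mu).
Proof.
by have [L L0] := smooth_potential_lipschitz; exact: lipschitz_continuous.
Qed.

Lemma smooth_potential_le_green x :
  ((smooth_potential e mu x)%:E <= green_potential mu x)%E.
Proof.
rewrite -smooth_potentialE; apply: ge0_le_integral => //.
- by move=> z _; rewrite lee_fin.
- exact: emeasurable_smooth_green_shift.
- exact: measurable_green_shift.
- by move=> z _; exact: smooth_green_le_green.
Qed.

(** By symmetry of the kernel, integrating against [mu] the potential of point masses [v j] at [x j]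
    amounts to evaluating the potential of [mu] at these points. *)
Lemma integral_weighted_smooth_green n (v x : 'I_n -> R) : (forall j, 0 <= v j) ->
  (\int[mu]_z (\sum_j v j * smooth_green c e (z - x j))%:E)%E =
  (\sum_j v j * smooth_potential e mu (x j))%:E.
Proof.
move=> v0.
have m j : measurable_fun [set: measurableTypeR R]
    (fun z : R => (v j * smooth_green c e (x j - z))%:E).
  apply/measurable_EFinP; apply: measurable_funM => //.
  exact: measurable_smooth_green_shift.
transitivity (\int[mu]_z \sum_j (v j * smooth_green c e (x j - z))%:E)%E.
  apply: eq_integral => z _; rewrite sumEFin; congr EFin.
  by apply: eq_bigr => j _; rewrite -smooth_greenN opprB.
rewrite ge0_integral_sum//; last by move=> j z _; rewrite lee_fin mulr_ge0.
rewrite -sumEFin; apply: eq_bigr => j _; rewrite EFinM -smooth_potentialE.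
rewrite -ge0_integralZl_EFin//; first by move=> z _; rewrite lee_fin.
exact: emeasurable_smooth_green_shift.
Qed.

End Smooth.

Lemma smooth_potential_nondecreasing x :
  nondecreasing_seq (fun n => smooth_potential n.+1%:R^-1 mu x).
Proof.
move=> m n mn; rewrite -lee_fin -!smooth_potentialE ?invr_gt0 ?ltr0n//.
apply: ge0_le_integral => //.
- by move=> z _; rewrite lee_fin ltW// smooth_green_gt0// invr_gt0 ltr0n.
- by apply: emeasurable_smooth_green_shift; rewrite invr_gt0 ltr0n.
- by apply: emeasurable_smooth_green_shift; rewrite invr_gt0 ltr0n.
- by move=> z _; rewrite lee_fin; exact: smooth_green_nondecreasing.
Qed.

Lemma smooth_potential_cvg x :
  (smooth_potential n.+1%:R^-1 mu x)%:E @[n --> \oo] --> green_potential mu x.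
Proof.
have E n : (smooth_potential n.+1%:R^-1 mu x)%:E =
    (\int[mu]_z (smooth_green c n.+1%:R^-1 (x - z))%:E)%E.
  by rewrite smooth_potentialE// invr_gt0 ltr0n.
under eq_cvg do rewrite E.
have -> : green_potential mu x =
    (\int[mu]_z limn (fun n => (smooth_green c n.+1%:R^-1 (x - z))%:E))%E.
  apply: eq_integral => z _; apply/esym/cvg_lim => //.
  exact: smooth_green_cvg.
apply: (@cvg_monotone_convergence _ (measurableTypeR R) R mu setT _
   (fun n z => (smooth_green c n.+1%:R^-1 (x - z))%:E)) => //.
- by move=> n; apply: emeasurable_smooth_green_shift; rewrite invr_gt0 ltr0n.
- by move=> n z _; rewrite lee_fin ltW// smooth_green_gt0// invr_gt0 ltr0n.
- by move=> z _ m n mn; rewrite lee_fin; exact: smooth_green_nondecreasing.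
Qed.

End GreenPotential.

(** * Comparison of two measures of equal mass *)

Section Domination.
Context {R : realType}.

(** Every point off the support lies in a null interval with rational endpoints, and there are
    countably many such intervals. *)
Lemma measure_support_setC (mu : {measure set (measurableTypeR R) -> \bar R}) :
  mu.-negligible (~` measure_support mu).
Proof.
pose G (q : rat * rat) : set R :=
  if mu `]ratr q.1, ratr q.2[%classic == 0%E then `]ratr q.1, ratr q.2[%classic
  else set0.
pose F n : set R := oapp G set0 (@unpickle (rat * rat)%type n).
apply: (@negligibleS _ _ _ mu (\bigcup_n F n)); last first.
  apply: negligible_bigcup => n; rewrite /F.
  case: unpickle => [q|]; last exact: negligible_set0.
  rewrite /= /G; case: eqP => [q0|_]; last exact: negligible_set0.
  apply/negligibleP => //; exact: measurable_itv.
move=> x; rewrite /measure_support /= => /existsNP[U] /not_implyP[oU] /not_implyP[Ux] muU.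
have /nbhs_ballP[r /= r0 rU] : nbhs x U by exact: open_nbhs_nbhs.
have [p /[!in_itv]/= /andP[p1 p2]] : exists q : rat, ratr q \in `](x - r), x[.
  by apply: rat_in_itvoo; rewrite ltrBlDr ltrDl.
have [q /[!in_itv]/= /andP[q1 q2]] : exists q : rat, ratr q \in `]x, (x + r)[.
  by apply: rat_in_itvoo; rewrite ltrDl.
suff Gx : G (p, q) x by exists (pickle (p, q)); [exact: I|rewrite /F pickleK].
rewrite /G; case: eqP => [_|]; first by rewrite /= in_itv/= p2.
case; apply/eqP; rewrite eq_le measure_ge0 andbT.
have -> : (0 = mu U)%E.
  by apply/eqP; rewrite eq_le measure_ge0/= leNgt; exact/negP.
apply: le_measure; rewrite ?inE; [exact: measurable_itv|exact: open_measurable|].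
move=> y; rewrite /= in_itv/= => /andP[y1 y2]; apply: rU.
by rewrite /ball/= ltr_norml; apply/andP; split; lra.
Qed.

Variable c : R.
Hypothesis c_gt0 : 0 < c.


(* Both potentials are integrated against the discretised equilibrium
   distribution of the interval. *)
Lemma smooth_potential_not_dominated
    (mu nu : {measure set (measurableTypeR R) -> \bar R}) (M a e eps : R) :
  0 < a -> 0 < e -> 0 < eps ->
  mu [set: R] = M%:E -> nu [set: R] = M%:E ->
  nu.-negligible (~` `[- a, a]%classic) ->
  ~ (forall x, - a <= x <= a ->
       smooth_potential c e nu x + eps <= smooth_potential c e mu x).
Proof.
move=> a0 e0 eps0 muM nuM nu0 dom.
have M0 := mass_ge0 muM.
have [L L0 HL] := smooth_green_lipschitz c_gt0 e0.
(* The mesh is fine enough for the final error [2 * M * L * h] to stay below [eps]. *)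
pose n := Num.truncn (4 * a * M * L / eps).
pose h := 2 * a / n.+1%:R.
have n0 : 0 < n.+1%:R :> R by rewrite ltr0n.
have h0 : 0 < h by rewrite divr_gt0// mulr_gt0.
have nh : n.+1%:R * h = 2 * a by rewrite /h mulrC divfK ?gt_eqF.
have Hh : 2 * M * L * h < eps.
  have : 4 * a * M * L / eps < n.+1%:R by exact: truncnS_gt.
  rewrite ltr_pdivrMr// => H.
  have -> : 2 * M * L * h = 4 * a * M * L / n.+1%:R.
    by rewrite /h; field; rewrite gt_eqF// -natr1.
  by rewrite ltr_pdivrMr// [eps * _]mulrC.
have [v [v0 v1]] := @grid_equilibrium _ n.+1 (smooth_green c e) h h0
  (fun t => smooth_green_gt0 t c_gt0 e0) (smooth_greenN c e)
  (fun s t => @smooth_green_le _ c e s t c_gt0 e0)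
  (fun t => smooth_green_convex c_gt0 e0 h0).
(* The [n.+2] nodes run from [- a] to [a], both included; the bound on [u] outside the interval
   relies on this. *)
pose x (j : 'I_n.+2) := - a + j%:R * h.
pose u z := \sum_j v j * smooth_green c e (z - x j).
pose A := \sum_j v j.
have A0 : 0 <= A by exact: sumr_ge0.
have xa j : - a <= x j <= a.
  have jh : 0 <= j%:R * h by rewrite mulr_ge0// ltW.
  have jn : j%:R * h <= n.+1%:R * h by rewrite ler_pM2r// ler_nat -ltnS.
  by rewrite /x; apply/andP; split; lra.
have ux i : u (x i) = 1.
  rewrite -(v1 i); apply: eq_bigr => j _; congr (_ * smooth_green c e _).
  by rewrite /x; ring.
have A1 : 1 <= A * logcoth c e.
  rewrite -(ux ord0) mulr_suml; apply: ler_sum => j _.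
  by rewrite ler_wpM2l// smooth_green_max.
have {A1}Agt0 : 0 < A.
  rewrite lt_neqAle A0 andbT; apply: contraTneq A1 => <-.
  by rewrite mul0r ler10.
have uL y z : `|u y - u z| <= L * `|y - z| * A.
  rewrite -sumrB mulr_sumr; apply: (le_trans (ler_norm_sum _ _ _)).
  apply: ler_sum => j _; rewrite -mulrBr normrM ger0_norm// mulrC ler_wpM2r//.
  apply: le_trans (HL _ _) _.
  by have -> : y - x j - (z - x j) = y - z by ring.
have u0 z : 0 <= u z.
  by apply: sumr_ge0 => j _; rewrite mulr_ge0// ltW// smooth_green_gt0.
(* A point of the interval is within [h] of the node to its left, where [u] is 1. *)
have near_grid z : - a <= z <= a -> `|u z - 1| <= L * h * A.
  move=> /andP[z1 z2].
  have zh0 : 0 <= (z + a) / h by rewrite divr_ge0 ?(ltW h0)//; lra.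
  have /andP[k1 k2] := truncn_itv zh0.
  have kn : (Num.truncn ((z + a) / h) < n.+2)%N.
    rewrite ltnS -(ler_nat R); apply: le_trans k1 _.
    by rewrite ler_pdivrMr// nh; lra.
  rewrite -(ux (Ordinal kn)); apply: le_trans (uL _ _) _.
  rewrite ler_wpM2r// ler_pM2l// /x/=.
  move: k1 k2; rewrite ler_pdivlMr// ltr_pdivrMr// => k1.
  rewrite -[_.+1%:R]natr1 mulrDl mul1r => k2.
  by rewrite ger0_norm; lra.
have LhA : 0 <= L * h * A by rewrite !mulr_ge0// ltW.
(* Beyond an endpoint every node is farther away than from that endpoint, where [u] is 1. A bound on
   the whole line is required, as [mu] may charge points outside the interval. *)
have u_le z : u z <= 1 + L * h * A.
  have [za|/ltW za] := leP z a; last first.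
    apply: (@le_trans _ _ 1); last by rewrite lerDl.
    rewrite -(ux ord_max); apply: ler_sum => j _; rewrite ler_wpM2l//.
    have xm : x ord_max = a by rewrite /x /= nh; ring.
    have /andP[xj1 xj2] := xa j.
    by rewrite xm; apply: smooth_green_le; rewrite ?subr_ge0// lerB.
  have [az|/ltW az] := leP (- a) z; last first.
    apply: (@le_trans _ _ 1); last by rewrite lerDl.
    rewrite -(ux ord0); apply: ler_sum => j _; rewrite ler_wpM2l//.
    have xm : x ord0 = - a by rewrite /x /= mul0r addr0.
    have /andP[xj1 xj2] := xa j.
    rewrite xm -(smooth_greenN _ _ (z - _)) -(smooth_greenN _ _ (- a - _)) !opprB.
    by apply: smooth_green_le; rewrite ?subr_ge0// lerB.
  have := near_grid z; rewrite az za => /(_ isT).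
  by rewrite ler_norml => /andP[_]; rewrite lerBlDl.
have um : measurable_fun [set: measurableTypeR R] u.
  apply: continuous_measurable_fun.
  apply: (@lipschitz_continuous _ _ (L * A)); first exact: mulr_gt0.
  by move=> s t; rewrite mulrAC.
have Umu : \sum_j v j * smooth_potential c e mu (x j) <= (1 + L * h * A) * M.
  rewrite -lee_fin -(integral_weighted_smooth_green c_gt0 muM e0)//.
  exact: (integral_le_mass muM).
(* [nu] is concentrated on the interval, so a lower bound on [u] there suffices; if that bound is
   negative, the nonnegativity of [u] does. *)
have Unu : (1 - L * h * A) * M <= \sum_j v j * smooth_potential c e nu (x j).
  rewrite -lee_fin -(integral_weighted_smooth_green c_gt0 nuM e0)//.
  have [b0|b0] := leP 0 (1 - L * h * A); last first.
    apply: (@le_trans _ _ 0%E).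
      by rewrite lee_fin mulr_le0_ge0// ltW.
    by apply: integral_ge0 => z _; rewrite lee_fin; exact: u0.
  rewrite EFinM -nuM -integral_cst//.
  apply: ae_ge0_le_integral => //.
  - by move=> z _; rewrite lee_fin; exact: u0.
  - exact/measurable_EFinP.
  apply: negligibleS nu0 => z /= /not_implyP[_] H; rewrite in_itv/= => /near_grid.
  by rewrite ler_norml => /andP[uz _]; apply: H; rewrite lee_fin -/(u z); lra.
have dom' : \sum_j v j * smooth_potential c e nu (x j) + eps * A <=
    \sum_j v j * smooth_potential c e mu (x j).
  rewrite mulr_sumr -big_split/=; apply: ler_sum => j _.
  by rewrite [eps * _]mulrC -mulrDr ler_wpM2l// dom.
(* Chaining the three bounds, the main terms [M] cancel because the masses agree. *)
have : eps * A <= 2 * M * L * h * A by lra.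
by rewrite ler_pM2r// leNgt Hh.
Qed.

End Domination.


Import HBNNSimple.

(** The integral of [f] is at most that of its positive part, a supremum over simple functions below
    it, hence below [g]. This covers functions whose measurability has not been established. *)
Lemma integral_le_measurable d (T : measurableType d) (R : realType)
    (mu : {measure set T -> \bar R}) (f g : T -> \bar R) :
  measurable_fun [set: T] g -> (forall x, 0 <= g x)%E ->
  (forall x, f x <= g x)%E -> (\int[mu]_x f x <= \int[mu]_x g x)%E.
Proof.
move=> mg g0 fg; rewrite integralE.
apply: (@le_trans _ _ (\int[mu]_x f^\+%E x)%E).
  by rewrite geeDl// oppe_le0 integral_ge0.
rewrite ge0_integralTE; last by move=> x; exact: funepos_ge0.
apply: ge_ereal_sup => _ [k kf <-]; rewrite -integralT_nnsfun.
apply: ge0_le_integral => //.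
- by move=> x _; rewrite lee_fin; exact: fun_ge0.
- exact/measurable_EFinP.
move=> x _; apply: (le_trans (kf x)).
by rewrite funeposE ge_max fg g0.
Qed.

(** * Logarithmic singularities through dyadic layers *)

Section SingularIntegrals.
Context {R : realType}.
Implicit Types (h t x z b : R).

(* A dyadic majorant, up to an additive constant, of the positive part of
   [ln (h / |t|)]. *)
Definition layer h t : \bar R :=
  (\sum_(0 <= j <oo) (ln 2 * (`|t| <= h / 2 ^+ j)%R%:R)%:E)%E.

Let ln2_gt0 : 0 < ln 2 :> R. Proof. by rewrite ln_gt0// ltr1n. Qed.

Lemma layer_term_ge0 h t j : (0 <= (ln 2 * (`|t| <= h / 2 ^+ j)%R%:R)%:E :> \bar R)%E.
Proof. by rewrite lee_fin mulr_ge0// ltW. Qed.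

Lemma layer_ge0 h t : (0 <= layer h t)%E.
Proof. by apply: nneseries_ge0 => j _ _; exact: layer_term_ge0. Qed.

Lemma layer_ge n h t : 0 < h -> `|t| <= h / 2 ^+ n ->
  ((n.+1%:R * ln 2)%:E <= layer h t)%E.
Proof.
move=> h0 tn.
apply: (@le_trans _ _ (\sum_(0 <= j < n.+1) (ln 2 * (`|t| <= h / 2 ^+ j)%R%:R)%:E)%E).
  rewrite sumEFin lee_fin big_mkord (eq_bigr (fun=> ln 2)).
    by rewrite sumr_const card_ord mulr_natl.
  move=> j _; suff -> : `|t| <= h / 2 ^+ j by rewrite mulr1.
  apply: (le_trans tn); rewrite ler_pM2l// lef_pV2 ?posrE ?exprn_gt0//.
  by rewrite ler_weXn2l ?ler1n// -ltnS.
apply: nneseries_lim_ge => j *; exact: layer_term_ge0.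
Qed.

Lemma layer0 h : 0 < h -> layer h 0 = +oo%E.
Proof.
move=> h0; apply: eq_infty => A.
apply: (@le_trans _ _ ((Num.truncn (A / ln 2)).+1%:R * ln 2)%:E).
  by rewrite lee_fin -ler_pdivrMr// ltW// truncnS_gt.
by apply: layer_ge => //; rewrite normr0 divr_ge0 ?exprn_ge0// ltW.
Qed.

Lemma expr2_unbounded A : exists n, A < 2 ^+ n :> R.
Proof.
exists (Num.truncn A).+1; apply: lt_trans (truncnS_gt A) _.
by rewrite -natrX ltr_nat ltn_expl.
Qed.

(** Each halving of the distance, starting from [h], costs at most [ln 2], and the layers containing
    [t] count the halvings required to pass below [t]. A general [g] serves both [logcoth] and
    [- ln]. *)
Lemma le_layer (g : R -> R) h t : 0 < h -> 0 < t ->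
  (forall r s, 0 < r -> r <= s -> g s <= g r) ->
  (forall s, 0 < s -> g (s / 2) <= g s + ln 2) ->
  ((g t)%:E <= (g h)%:E + layer h t)%E.
Proof.
move=> h0 t0 gdec ghalf.
have [th|ht] := leP t h; last first.
  by rewrite (@le_trans _ _ (g h)%:E) ?lee_fin ?gdec ?leeDl ?layer_ge0// ltW.
have gpow n : g (h / 2 ^+ n) <= g h + n%:R * ln 2.
  elim: n => [|n IH]; first by rewrite expr0 divr1 mul0r addr0.
  have -> : h / 2 ^+ n.+1 = h / 2 ^+ n / 2 by rewrite exprSr invfM mulrA.
  have hn : 0 < h / 2 ^+ n by rewrite divr_gt0// exprn_gt0.
  by apply: (le_trans (ghalf _ hn)); rewrite -[n.+1%:R]natr1 mulrDl mul1r; lra.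
have ex : exists n, h / 2 ^+ n.+1 < t.
  have [n hn] := expr2_unbounded (h / t); exists n.
  rewrite ltr_pdivrMr ?exprn_gt0//; rewrite ltr_pdivrMr// in hn.
  by rewrite exprS; have : 0 < t * 2 ^+ n by [rewrite mulr_gt0// exprn_gt0]; lra.
case: (ex_minnP ex) => n hn nmin.
have tn : t <= h / 2 ^+ n.
  case: n hn nmin => [_ _|n _ nmin]; first by rewrite expr0 divr1.
  by rewrite leNgt; apply/negP => /nmin; rewrite ltnn.
apply: (@le_trans _ _ ((g h)%:E + (n.+1%:R * ln 2)%:E)%E).
  rewrite -EFinD lee_fin; apply: le_trans (gpow n.+1); apply: gdec.
    by rewrite divr_gt0// exprn_gt0.
  exact: ltW.
by rewrite leeD2l// layer_ge// gtr0_norm.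
Qed.

Lemma green_le_layer c h t : 0 < c -> 0 < h ->
  (green c t <= (logcoth c h)%:E + layer h t)%E.
Proof.
move=> c0 h0; case: (eqVneq t 0) => [->|t0]; first by rewrite layer0// addey ?leey.
have nt0 : 0 < `|t| by rewrite normr_gt0.
have -> : layer h t = layer h `|t| by rewrite /layer normr_id.
rewrite greenE//; apply: le_layer => //.
  by move=> r s r0 rs; exact: logcoth_le.
by move=> s s0; exact: logcoth_half.
Qed.

Lemma oppe_lne_le_layer t : (- lne (`|t|)%:E <= layer 1 t)%E.
Proof.
case: (eqVneq t 0) => [->|t0]; first by rewrite layer0// leey.
have nt0 : 0 < `|t| by rewrite normr_gt0.
have -> : layer 1 t = layer 1 `|t| by rewrite /layer normr_id.
rewrite lne_EFin//.
have := @le_layer (fun s => - ln s) 1 `|t| ltr01 nt0.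
rewrite ln1 oppr0 add0e; apply.
  by move=> r s r0 rs; rewrite lerN2 ler_ln// posrE// (lt_le_trans r0).
by move=> s s0; rewrite ln_div ?posrE//; lra.
Qed.

Lemma layer_indicE h z j x :
  (`|x - z| <= h / 2 ^+ j)%R%:R = \1_(`[z - h / 2 ^+ j, z + h / 2 ^+ j]%classic : set R) x :> R.
Proof.
rewrite indicE; congr (nat_of_bool _)%:R; apply/idP/idP => [|].
  rewrite ler_norml => /andP[? ?]; apply/mem_set; rewrite /= in_itv/=.
  by apply/andP; split; lra.
rewrite inE /= in_itv/= => /andP[? ?].
by rewrite ler_norml; apply/andP; split; lra.
Qed.

Lemma measurable_layer h z :
  measurable_fun [set: measurableTypeR R] (fun x : R => layer h (x - z)).
Proof.
rewrite /layer; apply: ge0_emeasurable_sum => [j x _ _|j _].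
  exact: layer_term_ge0.
apply/measurable_EFinP; apply: measurable_funM => //.
rewrite (_ : (fun x => _) = \1_(`[z - h / 2 ^+ j, z + h / 2 ^+ j]%classic : set R)).
  by apply: measurable_indic; exact: measurable_itv.
by apply/funext => x; rewrite layer_indicE.
Qed.

(** Layer [j] contributes at most [ln 2 * C] times the length [2 * h / 2 ^+ j] of an interval; the
    geometric series doubles the first term. *)
Lemma integral_layer_le (m : {measure set (measurableTypeR R) -> \bar R}) (C h z : R) :
  0 <= C -> 0 < h ->
  (forall r : R, 0 < r -> (m (`[(z - r)%R, (z + r)%R]%classic : set R) <= (C * (2 * r))%:E)%E) ->
  (\int[m]_x layer h (x - z) <= (4 * h * ln 2 * C)%:E)%E.
Proof.
move=> C0 h0 mC; rewrite /layer integral_nneseries//; last first.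
  by move=> j x _; exact: layer_term_ge0.
  move=> j; apply/measurable_EFinP; apply: measurable_funM => //.
  rewrite (_ : (fun x => _) = \1_(`[z - h / 2 ^+ j, z + h / 2 ^+ j]%classic : set R)).
    by apply: measurable_indic; exact: measurable_itv.
  by apply/funext => x; rewrite layer_indicE.
have term j : (\int[m]_x (ln 2 * (`|x - z| <= h / 2 ^+ j)%R%:R)%:E <=
    (ln 2 * (C * (2 * (h / 2 ^+ j))))%:E)%E.
  under eq_integral => x _ do rewrite layer_indicE EFinM.
  rewrite ge0_integralZl_EFin ?(ltW ln2_gt0)//; first last.
  - by apply/measurable_EFinP; apply: measurable_indic; exact: measurable_itv.
  rewrite integral_indic//.
  rewrite setIT EFinM lee_pmul2l// ?lte_fin//.
  by apply: mC; rewrite divr_gt0// exprn_gt0.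
apply: lime_le.
  by apply: is_cvg_nneseries => j _ _; apply: integral_ge0 => x _; exact: layer_term_ge0.
apply: nearW => n; apply: le_trans (lee_sum _ (fun j _ => term j)) _.
rewrite sumEFin lee_fin.
have -> : \sum_(0 <= j < n) ln 2 * (C * (2 * (h / 2 ^+ j))) =
  4 * h * ln 2 * C - 4 * h * ln 2 * C / 2 ^+ n.
  elim: n => [|n IH]; first by rewrite big_nil expr0 divr1 subrr.
  rewrite big_nat_recr//= IH exprS; field.
  by rewrite expf_neq0.
by rewrite gerBl divr_ge0 ?exprn_ge0// !mulr_ge0// ltW.
Qed.

End SingularIntegrals.

(** * Averages of the kernel over short intervals *)

Section Averages.
Context {R : realType}.
Implicit Types (h x y z b : R).

Definition seg y h : set R := `[(y - h), (y + h)]%classic.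

Lemma segP y h x : seg y h x <-> `|x - y| <= h.
Proof.
rewrite /seg /= in_itv/= ler_norml; split => /andP[? ?]; apply/andP; split; lra.
Qed.

Lemma measurable_seg y h : measurable (seg y h : set (measurableTypeR R)).
Proof. exact: measurable_itv. Qed.

Lemma lebesgue_seg y h : 0 < h ->
  @lebesgue_measure R (seg y h) = (2 * h)%:E.
Proof.
move=> h0; rewrite /seg lebesgue_measure_itv/= lte_fin ifT; last by lra.
by rewrite -EFinD; congr EFin; ring.
Qed.

Lemma measurable_seg_indic y h :
  measurable_fun [set: measurableTypeR R] (fun x : R => (\1_(seg y h) x)%:E : \bar R).
Proof.
by apply/measurable_EFinP; apply: measurable_indic; exact: measurable_seg.
Qed.

Lemma integral_cst_seg y h b : 0 < h -> 0 <= b ->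
  (\int[@lebesgue_measure R]_x (b%:E * (\1_(seg y h) x)%:E))%E = (b * (2 * h))%:E.
Proof.
move=> h0 b0; rewrite ge0_integralZl_EFin//; last exact: measurable_seg_indic.
rewrite integral_indic// ?setIT; last exact: measurable_seg.
by rewrite EFinM; congr (_ * _)%E; exact: lebesgue_seg.
Qed.

Lemma integral_seg_le (f : R -> \bar R) y h b : 0 < h -> 0 <= b ->
  measurable_fun [set: measurableTypeR R] f -> (forall x, 0 <= f x)%E ->
  (forall x, seg y h x -> f x <= b%:E)%E ->
  (\int[@lebesgue_measure R]_x (f x * (\1_(seg y h) x)%:E) <= (b * (2 * h))%:E)%E.
Proof.
move=> h0 b0 mf f0 fb; rewrite -(integral_cst_seg y h0 b0).
apply: integral_le_measurable => [|x|x].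
- exact: measurable_funeM (measurable_seg_indic _ _).
- by rewrite mule_ge0// lee_fin.
- rewrite indicE; case: (boolP (x \in _)) => [|_]; last by rewrite !mule0.
  by rewrite inE => xs; rewrite !mule1; exact: fb.
Qed.

Lemma integral_seg_ge (f : R -> \bar R) (N : set R) y h b : 0 < h ->
  measurable_fun [set: measurableTypeR R] f -> (forall x, 0 <= f x)%E ->
  (@lebesgue_measure R).-negligible N ->
  (forall x, seg y h x -> ~ N x -> b%:E <= f x)%E ->
  ((b * (2 * h))%:E <= \int[@lebesgue_measure R]_x (f x * (\1_(seg y h) x)%:E))%E.
Proof.
move=> h0 mf f0 N0 fb.
have fi0 x : (0 <= f x * (\1_(seg y h) x)%:E)%E by rewrite mule_ge0// lee_fin.
have [b0|b0] := ltP b 0.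
  apply: (@le_trans _ _ 0%E); last by apply: integral_ge0 => x _; exact: fi0.
  by rewrite lee_fin nmulr_rle0// ltW// mulr_gt0.
rewrite -(integral_cst_seg y h0 b0).
apply: (@ae_ge0_le_integral _ (measurableTypeR R)) => //.
- by move=> x _; rewrite mule_ge0// lee_fin.
- exact: measurable_funeM (measurable_seg_indic _ _).
- exact: emeasurable_funM mf (measurable_seg_indic _ _).
apply: negligibleS N0 => x /= /not_implyP[_] H; apply: contrapT => Nx; apply: H.
rewrite indicE; case: (boolP (x \in _)) => [|_]; last by rewrite !mule0.
by rewrite inE => xs; rewrite !mule1; exact: fb.
Qed.

Variable c : R.
Hypothesis c_gt0 : 0 < c.

(** The restriction to the segment is an indicator factor, so that Tonelli applies on the whole
    plane. *)
Definition seg_green y h z : \bar R :=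
  (\int[@lebesgue_measure R]_x (green c (x - z) * (\1_(seg y h) x)%:E))%E.

Lemma measurable_green_shiftr z :
  measurable_fun [set: measurableTypeR R] (fun x : R => green c (x - z)).
Proof.
apply: (measurableT_comp (measurable_green c_gt0)).
by apply: measurable_funB => //.
Qed.

(** The kernel is at most [logcoth c h] plus a layer, and the layer integrates to [4 * h * ln 2]
    wherever [z] is. *)
Lemma seg_green_le_radius y h z : 0 < h ->
  (seg_green y h z <= ((logcoth c h + 2 * ln 2) * (2 * h))%:E)%E.
Proof.
move=> h0.
have ln2 : 0 < ln 2 :> R by rewrite ln_gt0// ltr1n.
have lh : 0 <= logcoth c h by rewrite ltW// logcoth_gt0.
have H1 : (\int[@lebesgue_measure R]_x layer h (x - z) <= (4 * h * ln 2 * 1)%:E)%E.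
  apply: integral_layer_le => // r r0; rewrite mul1r -(lebesgue_seg z r0); exact: lexx.
apply: (@le_trans _ _ (\int[@lebesgue_measure R]_x
    ((logcoth c h)%:E * (\1_(seg y h) x)%:E + layer h (x - z)))%E).
  apply: integral_le_measurable => [|x|x].
  - apply: emeasurable_funD; last exact: measurable_layer.
    exact: measurable_funeM (measurable_seg_indic _ _).
  - by rewrite adde_ge0 ?layer_ge0// mule_ge0// lee_fin.
  - rewrite indicE; case: (boolP (x \in _)) => [_|_].
      by rewrite !mule1; exact: green_le_layer.
    by rewrite !mule0 add0e layer_ge0.
rewrite ge0_integralD//; last 4 first.
- by move=> x _; rewrite mule_ge0// lee_fin.
- exact: measurable_funeM (measurable_seg_indic _ _).
- by move=> x _; exact: layer_ge0.
- exact: measurable_layer.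
rewrite integral_cst_seg//; apply: (le_trans (leeD2l _ H1)).
by rewrite -EFinD lee_fin; lra.
Qed.

Lemma green_half_le t : (green c (t / 2) <= green c t + (ln 2)%:E)%E.
Proof.
case: (eqVneq t 0) => [->|t0]; first by rewrite mul0r green0 addye.
have t20 : t / 2 != 0 by rewrite mulf_neq0// invr_eq0.
rewrite !greenE// normrM (@ger0_norm _ 2^-1)// -EFinD lee_fin.
by rewrite logcoth_half// normr_gt0.
Qed.

Lemma green_le s t : `|s| <= `|t| -> (green c t <= green c s)%E.
Proof.
move=> st; case: (eqVneq s 0) => [->|s0]; first by rewrite green0 leey.
have s0' : 0 < `|s| by rewrite normr_gt0.
have t0 : t != 0 by rewrite -normr_gt0 (lt_le_trans s0').
by rewrite !greenE// lee_fin logcoth_le.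
Qed.

(** Supplies a majorant of the averages independent of [h]. If [|y - z| >= 2 * h], distances to [z]
    on the segment shrink at most by half, which costs [ln 2]; otherwise the previous bound and one
    halving cost [3 * ln 2]. *)
Lemma seg_green_le_center y h z : 0 < h ->
  (seg_green y h z <= (green c (y - z) + (3 * ln 2)%:E) * (2 * h)%:E)%E.
Proof.
move=> h0; set t := y - z.
have ln2 : 0 < ln 2 :> R by rewrite ln_gt0// ltr1n.
case: (eqVneq t 0) => [->|t0].
  by rewrite green0 addye// gt0_mulye ?leey// lte_fin mulr_gt0.
have nt0 : 0 < `|t| by rewrite normr_gt0.
rewrite greenE// -EFinD -EFinM.
have lt0 : 0 < logcoth c `|t| by exact: logcoth_gt0.
have [th|ht] := leP (2 * h) `|t|.
  apply: integral_seg_le => //.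
  - by lra.
  - exact: measurable_green_shiftr.
  - by move=> x; exact: green_ge0.
  move=> x /segP xy.
  apply: (@le_trans _ _ (green c (t / 2))).
    apply: green_le; rewrite normrM (@ger0_norm _ 2^-1)//.
    have : `|t| <= `|x - y| + `|x - z|.
      have -> : t = - (x - y) + (x - z) by rewrite /t; ring.
      by apply: (le_trans (ler_normD _ _)); rewrite normrN.
    by lra.
  apply: (le_trans (green_half_le _)).
  by rewrite greenE// -EFinD lee_fin; lra.
apply: (le_trans (seg_green_le_radius y z h0)).
rewrite lee_fin ler_pM2r ?mulr_gt0//.
have H1 : logcoth c h <= logcoth c (2 * h) + ln 2.
  have h20 : 0 < 2 * h by rewrite mulr_gt0.
  by have := logcoth_half c_gt0 h20; rewrite mulrAC divff// mul1r.
have H2 : logcoth c (2 * h) <= logcoth c `|t| by apply: logcoth_le => //; exact: ltW.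
by lra.
Qed.

Definition mean_green y (n : nat) z : \bar R :=
  ((2 * n.+1%:R^-1)^-1%:E * seg_green y n.+1%:R^-1 z)%E.

(** Short segments around [y] keep distance [|y - z| / 2] from [z], a range where the kernel is
    Lipschitz. *)
Lemma mean_green_cvg y z : y != z ->
  mean_green y n z @[n --> \oo] --> green c (y - z).
Proof.
move=> yz; set t := y - z.
have t0 : t != 0 by rewrite subr_eq0.
have nt0 : 0 < `|t| / 2 by rewrite divr_gt0// normr_gt0.
have [L L0 HL] := logcoth_lipschitz c_gt0 nt0.
rewrite greenE//; set g := logcoth c `|t|.
have key h x : 0 < h -> h <= `|t| / 2 -> seg y h x ->
    ((g - L * h)%:E <= green c (x - z) <= (g + L * h)%:E)%E.
  move=> h0 ht /segP xy.
  have D : `| `|x - z| - `|t| | <= h.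
    apply: le_trans xy; apply: le_trans (ler_dist_dist _ _) _.
    by have -> : x - z - t = x - y by rewrite /t; ring.
  have xz : `|t| / 2 <= `|x - z|.
    by move: D; rewrite ler_norml => /andP[]; lra.
  have xz0 : x - z != 0 by rewrite -normr_gt0 (lt_le_trans nt0).
  rewrite greenE// !lee_fin -ler_distlC distrC.
  apply: le_trans (HL _ _ xz _) _; first by lra.
  by rewrite ler_pM2l.
apply: (@squeeze_cvge _ _ _ _ (fun n => (g - L * n.+1%:R^-1)%:E) _
   (fun n => (g + L * n.+1%:R^-1)%:E)).
- near=> n.
  have hn0 : 0 < n.+1%:R^-1 :> R by rewrite invr_gt0 ltr0n.
  have hn : n.+1%:R^-1 <= `|t| / 2 by near: n; exact: near_invS_le.
  have h20 : 0 < 2 * n.+1%:R^-1 :> R by rewrite mulr_gt0.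
  rewrite /mean_green muleC; apply/andP; split.
    rewrite lee_pdivlMr// -EFinM.
    apply: (integral_seg_ge _ _ _ (negligible_set0 _)) => //.
    + exact: measurable_green_shiftr.
    + by move=> x; exact: green_ge0.
    + by move=> x sx _; have /andP[] := key _ x hn0 hn sx.
  rewrite lee_pdivrMr// -EFinM; apply: integral_seg_le => //.
  + by rewrite addr_ge0 ?mulr_ge0// ltW// logcoth_gt0// normr_gt0.
  + exact: measurable_green_shiftr.
  + by move=> x; exact: green_ge0.
  + by move=> x sx; have /andP[] := key _ x hn0 hn sx.
- apply: cvg_EFin; first exact: nearW.
  rewrite -[X in _ --> X]subr0 -[X in _ --> _ - X](mulr0 L).
  apply: cvgB; first exact: cvg_cst.
  by apply: cvgM; [exact: cvg_cst|exact: cvg_harmonic].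
- apply: cvg_EFin; first exact: nearW.
  rewrite -[X in _ --> X]addr0 -[X in _ --> _ + X](mulr0 L).
  apply: cvgD; first exact: cvg_cst.
  by apply: cvgM; [exact: cvg_cst|exact: cvg_harmonic].
Unshelve. all: by end_near. Qed.

End Averages.

(** * From almost everywhere to everywhere lower bounds on potentials *)

Section LowerBound.
Context {R : realType}.
Variable c : R.
Hypothesis c_gt0 : 0 < c.

Section FiniteMeasure.
Variable mu : {finite_measure set (measurableTypeR R) -> \bar R}.

Let F y h (p : measurableTypeR R * measurableTypeR R) : \bar R :=
  (green c (p.2 - p.1)%R * (\1_(seg y h) p.2)%:E)%E.

Let measurable_F y h : measurable_fun setT (F y h).
Proof.
apply: emeasurable_funM.
  apply: (measurableT_comp (measurable_green c_gt0)).
  by apply: measurable_funB; [exact: measurable_snd|exact: measurable_fst].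
apply: (measurableT_comp (measurable_seg_indic y h)).
exact: measurable_snd.
Qed.

Let F_ge0 y h p : (0 <= F y h p)%E.
Proof. by rewrite mule_ge0 ?green_ge0// lee_fin. Qed.

Lemma measurable_seg_green y h :
  measurable_fun [set: measurableTypeR R] (seg_green c y h).
Proof.
exact: (@measurable_fun_fubini_tonelli_F _ _ (measurableTypeR R)
  (measurableTypeR R) R (@lebesgue_measure R) (F y h) (@measurable_F y h) (F_ge0 y h)).
Qed.

Lemma measurable_green_potential :
  measurable_fun [set: measurableTypeR R] (green_potential c mu).
Proof.
pose G (p : measurableTypeR R * measurableTypeR R) : \bar R := green c (p.1 - p.2)%R.
have mG : measurable_fun setT G.
  apply: (measurableT_comp (measurable_green c_gt0)).
  by apply: measurable_funB; [exact: measurable_fst|exact: measurable_snd].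
have G0 p : (0 <= G p)%E by exact: green_ge0.
exact: (@measurable_fun_fubini_tonelli_F _ _ (measurableTypeR R)
  (measurableTypeR R) R mu G mG G0).
Qed.

Lemma green_potential_ge0 x : (0 <= green_potential c mu x)%E.
Proof. by apply: integral_ge0 => z _; exact: green_ge0. Qed.

Lemma integral_seg_green y h :
  (\int[mu]_z seg_green c y h z =
   \int[@lebesgue_measure R]_x (green_potential c mu x * (\1_(seg y h) x)%:E))%E.
Proof.
have := @fubini_tonelli _ _ (measurableTypeR R) (measurableTypeR R) R mu
  (@lebesgue_measure R) (F y h) (@measurable_F y h) (F_ge0 y h).
rewrite /F /= => ->; apply: eq_integral => x _.
rewrite ge0_integralZr//; first exact: measurable_green_shift.
by move=> z _; exact: green_ge0.
Qed.

(** By Tonelli the average of the potential over a segment is the integral of the averaged kernel,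
    which tends to the potential at [y] by dominated convergence. The averages ignore [N]. *)
Lemma green_potential_ge_ae y delta m (N : set R) : 0 < delta ->
  (@lebesgue_measure R).-negligible N ->
  (forall x, `|x - y| <= delta -> ~ N x -> (m%:E <= green_potential c mu x)%E) ->
  (m%:E <= green_potential c mu y)%E.
Proof.
(* Arguing by contradiction makes the potential at [y] finite, hence the majorant integrable. *)
move=> delta0 N0 mU; rewrite leNgt; apply/negP => Um.
have ig : mu.-integrable setT (fun z => green c (y - z)).
  apply/integrableP; split; first exact: measurable_green_shift.
  under eq_integral => z _ do rewrite gee0_abs ?green_ge0//.
  exact: lt_trans Um (ltry _).
have ln2 : 0 < ln 2 :> R by rewrite ln_gt0// ltr1n.
have iB : mu.-integrable setT (fun z => green c (y - z) + (3 * ln 2)%:E)%E.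
  by apply: integrableD => //; exact: finite_measure_integrable_cst.
have mean_ge0 n z : (0 <= mean_green c y n z)%E.
  apply: mule_ge0; first by rewrite lee_fin invr_ge0 mulr_ge0.
  apply: integral_ge0 => x _; apply: mule_ge0; first exact: green_ge0.
  by rewrite lee_fin.
have [||||_ _ lim] := @dominated_convergence _ (measurableTypeR R) R mu setT measurableT
    (mean_green c y) (fun z => green c (y - z)) _ _ _ _ iB.
- by move=> n; apply: measurable_funeM; exact: measurable_seg_green.
- exact: measurable_green_shift.
(* The averages may fail to converge to the kernel only at [z = y], where the kernel is infinite;
   integrability makes this a null event. *)
- have := integrable_ae measurableT ig; apply: filterS => z /(_ I) fin _.
  apply: mean_green_cvg => //; apply: contraTneq fin => ->.
  by rewrite subrr green0.
- apply: aeW => z n _; rewrite gee0_abs ?mean_ge0// /mean_green muleC.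
  have h0 : 0 < n.+1%:R^-1 :> R by rewrite invr_gt0 ltr0n.
  by rewrite lee_pdivrMr ?mulr_gt0// seg_green_le_center.
move: Um; apply/negP; rewrite -leNgt.
rewrite /green_potential -(cvg_lim _ lim)//; apply: lime_ge; first by apply/cvg_ex; eexists; exact: lim.
near=> n; rewrite /=.
have h0 : 0 < n.+1%:R^-1 :> R by rewrite invr_gt0 ltr0n.
have hd : n.+1%:R^-1 <= delta by near: n; exact: near_invS_le.
rewrite /mean_green ge0_integralZl_EFin//; last 2 first.
- by move=> z _; apply: integral_ge0 => x _; rewrite mule_ge0 ?green_ge0// lee_fin.
- exact: measurable_seg_green.
rewrite integral_seg_green muleC lee_pdivlMr ?mulr_gt0// -EFinM.
apply: (integral_seg_ge _ _ _ N0) => //.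
- exact: measurable_green_potential.
- exact: green_potential_ge0.
- by move=> x /segP xy Nx; apply: mU => //; exact: le_trans xy hd.
Unshelve. all: by end_near. Qed.

End FiniteMeasure.
End LowerBound.

(** * Logarithmic capacity against Lebesgue measure *)

Lemma mnormalizeE d (T : measurableType d) (R : realType)
    (mu : {measure set T -> \bar R}) (P : probability T R) (k : R) (A : set T) :
  0 < k -> mu [set: T] = k%:E -> mnormalize mu P A = (mu A * k^-1%:E)%E.
Proof. by move=> k0 muk; rewrite /mnormalize muk eqe gt_eqF. Qed.

Section Capacity.
Context {R : realType}.

(** The hypothesis says that the density is at most [C]; the layer bound with [h = 1] then controls
    the inner integral uniformly in [x]. *)
Lemma log_energy_le (nu : probability (measurableTypeR R) R) (C : R) : 0 <= C ->
  (forall z r : R, 0 < r ->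
     (nu (`[(z - r)%R, (z + r)%R]%classic : set R) <= (C * (2 * r))%:E)%E) ->
  (log_energy nu <= (4 * ln 2 * C)%:E)%E.
Proof.
move=> C0 nuC; have ln2 : 0 < ln 2 :> R by rewrite ln_gt0// ltr1n.
have B0 : 0 <= 4 * ln 2 * C by rewrite !mulr_ge0// ltW.
have -> : (4 * ln 2 * C)%:E = (\int[nu]_x cst (4 * ln 2 * C)%:E x)%E.
  rewrite integral_cst// [X in (_ * X)%E](_ : _ = 1%E) ?mule1//.
  exact: probability_setT.
apply: integral_le_measurable => // x.
apply: (@le_trans _ _ (\int[nu]_y layer 1 (y - x))%E).
  apply: integral_le_measurable => [|y|y].
  - exact: measurable_layer.
  - exact: layer_ge0.
  - by rewrite distrC; exact: oppe_lne_le_layer.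
have := @integral_layer_le R nu C 1 x C0 ltr01 (nuC x).
by rewrite mulr1.
Qed.

(** Normalised Lebesgue measure on [K] has bounded density, hence energy bounded above. *)
Lemma compact_capacity_gt0 (K : set R) : compact K ->
  (0 < @lebesgue_measure R K)%E -> (0 < compact_capacity K)%E.
Proof.
move=> cK K0; have mK : measurable (K : set (measurableTypeR R)) by exact: compact_measurable.
have Koo : (@lebesgue_measure R K < +oo)%E by exact: compact_finite_measure.
pose k := fine (@lebesgue_measure R K).
have kE : @lebesgue_measure R K = k%:E by rewrite fineK// ge0_fin_numE// ltW.
have k0 : 0 < k by rewrite -lte_fin -kE.
(* The Dirac mass is only the default of [mnormalize] for a zero or infinite total mass. *)
pose nu : probability (measurableTypeR R) R :=
  mnormalize (mrestr (@lebesgue_measure R) mK) \d_(0 : measurableTypeR R).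
have E1 : mrestr (@lebesgue_measure R) mK [set: measurableTypeR R] = k%:E.
  rewrite -kE; transitivity (@lebesgue_measure R ([set: R] `&` K)) => //.
  by rewrite setTI.
have nuE A : nu A = (@lebesgue_measure R (A `&` K) * k^-1%:E)%E.
  exact: (@mnormalizeE _ _ _ (mrestr (@lebesgue_measure R) mK)).
have nuK : nu K = 1%E.
  by rewrite nuE setIid kE -EFinM divff// gt_eqF.
have le_nu : (log_energy nu <= (4 * ln 2 * k^-1)%:E)%E.
  apply: log_energy_le => [|z r r0]; first by rewrite invr_ge0 ltW.
  rewrite nuE muleC EFinM lee_pmul2l ?lte_fin ?invr_gt0//.
  rewrite -(lebesgue_seg z r0); apply: le_measure; rewrite ?inE.
  - by apply: measurableI => //; exact: measurable_seg.
  - exact: measurable_seg.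
  - exact: subIsetl.
rewrite /compact_capacity.
apply: (@lt_le_trans _ _ (expeR (- (4 * ln 2 * k^-1)%:E))).
  by rewrite /= lte_fin expR_gt0.
rewrite lee_expeR leeN2; apply: le_trans le_nu.
by apply: ereal_inf_lbound; exists nu.
Qed.

(** [log_capacity] is an inner capacity, a supremum over compact subsets, so exceptional points are
    controlled through compact sets. *)
Lemma quasi_everywhere_null (S : set R) (P : R -> Prop) (K : set R) :
  quasi_everywhere S P -> compact K -> K `<=` S -> (forall x, K x -> ~ P x) ->
  @lebesgue_measure R K = 0%E.
Proof.
move=> qe cK KS KP; apply/eqP; rewrite eq_le measure_ge0 andbT leNgt.
apply/negP => /(compact_capacity_gt0 cK); apply/negP; rewrite -leNgt -qe.
by apply: ereal_sup_ubound; exists K => //; split => // x Kx; split; [exact: KS|exact: KP].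
Qed.

End Capacity.

(** * Continuity of the logarithm of the weight *)

Section LogWeight.
Context {R : realType}.

Lemma logw_continuous (d : R) (w : R[i] -> R[i]) :
  0 < d -> weight_function d w -> continuous (logw w).
Proof.
move=> d0 [[[w_an _ _ _] _ w_pos] _ _] x.
have Rew_gt0 : 0 < complex.Re (w (x%:C)%C).
  by have := w_pos x; rewrite ltcE => /andP[].
rewrite (_ : logw w = @ln R \o (fun y : R => complex.Re (w (y%:C)%C)))//.
apply: continuous_comp; last exact: continuous_ln.
have w_cont : {for (x%:C)%C, continuous (w : R[i]^o -> R[i]^o)}.
  apply: differentiable_continuous; apply/derivable1_diffP; apply: w_an.
  by rewrite /strip /= normr0.
apply/cvgrPdist_lt => eps eps0.
have epsC : 0 < (eps%:C)%C by rewrite ltcR.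
move/cvgrPdist_lt : w_cont => /(_ _ epsC) /nbhs_ballP[r /= r0 rw].
(* Radii of balls in [R[i]] are complex numbers; a positive one is real. *)
have [rE r0'] : (complex.Re r)%:C%C = r /\ 0 < complex.Re r.
  by move: r0; rewrite ltcE => /andP[/eqP/= ri rr]; case: r {rw} ri rr => a b /= ->.
apply/nbhs_ballP; exists (complex.Re r) => //= y xy.
have : ball ((x%:C)%C : R[i]^o) r ((y%:C)%C : R[i]^o).
  rewrite -rE /ball /= -rmorphB normc_def/= expr0n addr0 sqrtr_sqr ltcR.
  exact: xy.
move/rw => /=; rewrite -ltcR; apply: le_lt_trans.
by rewrite -raddfB; exact: normc_ge_Re.
Qed.

End LogWeight.

(** * Consequences of the equilibrium conditions *)

Section Equilibrium.
Context {R : realType}.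

(** A Dini-type argument: the sets where [g < f n] are open and increase with [n], so one of them
    contains [K]. *)
Lemma nondecreasing_cover (K : set R) (f : nat -> R -> R) (g : R -> R) :
  compact K -> (forall n, continuous (f n)) -> continuous g ->
  (forall x, nondecreasing_seq (f ^~ x)) ->
  (forall x, K x -> exists n, g x < f n x) ->
  exists n, forall x, K x -> g x < f n x.
Proof.
move=> /compact_near_coveringP cK fc gc fnd gf.
have [|n _ Hn] := cK nat \oo (fun n x => g x < f n x) _; last first.
  by exists n => x Kx; exact: (Hn n (leqnn n) x Kx).
move=> x /gf[n fx].
have fg : continuous (fun y => f n y - g y).
  by move=> y; apply: cvgB; [exact: fc|exact: gc].
have pos : 0 < f n x - g x by rewrite subr_gt0.
exists ([set y | 0 < f n y - g y], [set m | (n <= m)%N]) => /=.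
  by split; [exact: cvgr_gt (fg x) _ pos|exists n].
by move=> [y m] /= [gy nm]; apply: lt_le_trans (fnd y _ _ nm); rewrite -subr_gt0.
Qed.

Lemma oppeD_eq (u : \bar R) (q k : R) :
  (- u + q%:E = (- k)%:E)%E -> u = (k + q)%:E.
Proof. by case: u => [u [] ?|//|//]; congr EFin; lra. Qed.

Lemma oppeD_le (u : \bar R) (q k : R) :
  ((- u + q%:E <= (- k)%:E) = ((k + q)%:E <= u))%E.
Proof.
case: u => [u||]; last 2 first.
- by rewrite leNye leey.
- by rewrite leeNy_eq leye_eq.
by rewrite /= !lee_fin; apply/idP/idP; lra.
Qed.

Lemma potentialE (d : R) (mu : {measure set (measurableTypeR R) -> \bar R}) (x : R) :
  0 < d -> potential d mu x = (- green_potential (pi / (4 * d)) mu x)%E.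
Proof.
move=> d0; have c0 : 0 < pi / (4 * d) :> R by rewrite divr_gt0 ?pi_gt0 ?mulr_gt0.
rewrite /potential /green_potential -integral_ge0N; last first.
  by move=> z _; exact: green_ge0.
by apply: eq_integral => z _; rewrite oppeK.
Qed.

Variable c : R.
Hypothesis c_gt0 : 0 < c.
Variables (mu : {measure set (measurableTypeR R) -> \bar R}) (M : R).
Hypothesis mu_mass : mu [set: R] = M%:E.
Variables (a k : R) (Q : R -> R).
Hypotheses (a_gt0 : 0 < a) (Q_cont : continuous Q).
Hypothesis equil : quasi_everywhere `[- a, a]%classic
  (fun x => (- green_potential c mu x + (Q x)%:E)%E = (- k)%:E).

Let sp_cont (e : R) : 0 < e -> continuous (fun y => smooth_potential c e mu y - Q y).
Proof.
move=> e0 y; apply: cvgB; last exact: Q_cont.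
exact: (smooth_potential_continuous c_gt0 mu_mass e0).
Qed.

(* A strict inequality at one point would persist, by continuity of the smoothed
   potential, on an interval, and intervals have positive capacity. *)
Lemma smooth_potential_le_equilibrium (e x : R) : 0 < e -> - a <= x <= a ->
  smooth_potential c e mu x <= k + Q x.
Proof.
move=> e0 /andP[x1 x2]; rewrite leNgt; apply/negP => kx.
have : \forall y \near x, k < smooth_potential c e mu y - Q y.
  by apply: (cvgr_gt _ (sp_cont e0 (x := x))); lra.
move=> /nbhs_ballP[r /= r0 rk].
(* Clipping to [[- a, a]] leaves a nondegenerate interval even when [x] is an endpoint, and [r / 2]
   keeps the closed interval inside the ball. *)
pose l : R := Num.max (x - r / 2) (- a); pose u : R := Num.min (x + r / 2) a.
have lu : l < u.
  have a0 : 0 < a := a_gt0.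
  by rewrite gt_max !lt_min; apply/andP; split; apply/andP; split; lra.
have := @quasi_everywhere_null R _ _ `[l, u]%classic equil (segment_compact (a := l) (b := u)).
have Ilu y : `[l, u]%classic y -> (x - r / 2 <= y <= x + r / 2) /\ (- a <= y <= a).
  rewrite /= in_itv/= /l /u ge_max le_min.
  by move=> /andP[/andP[-> ->] /andP[-> ->]].
have H1 : `[l, u]%classic `<=` `[- a, a]%classic.
  by move=> y /Ilu[_]; rewrite /= in_itv.
have H2 y : `[l, u]%classic y -> ~ (- green_potential c mu y + (Q y)%:E = (- k)%:E)%E.
  move=> /Ilu[/andP[y1 y2] _] /oppeD_eq Uy.
  have := smooth_potential_le_green c_gt0 mu_mass e0 y; rewrite Uy lee_fin.
  have /rk kS : ball x r y by rewrite /ball /= ltr_norml; apply/andP; split; lra.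
  by apply/negP; rewrite -ltNge -ltrBrDr.
move=> /(_ H1 H2); rewrite lebesgue_measure_itv/= lte_fin lu => /eqP.
by rewrite -EFinD eqe subr_eq0 gt_eqF.
Qed.

Hypothesis outside : forall x, ~ `[- a, a]%classic x ->
  (- green_potential c mu x + (Q x)%:E <= (- k)%:E)%E.

(** Together these sets exhaust the points of the interval where the lower bound fails. Bounding all
    smoothed potentials, which are continuous, makes each set compact, as the passage from zero
    capacity to zero measure requires. *)
Let defect n : set R := [set x | - a <= x <= a /\
  forall m, smooth_potential c m.+1%:R^-1 mu x - Q x <= k - n.+1%:R^-1].

Let defect_null n : (@lebesgue_measure R).-negligible (defect n).
Proof.
have defE : defect n = `[- a, a]%classic `&` \bigcap_(m in [set: nat])
    [set x | smooth_potential c m.+1%:R^-1 mu x - Q x <= k - n.+1%:R^-1].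
  apply/seteqP; split => x; rewrite /defect /= in_itv/= => -[? H]; split => // m.
    by move=> _; exact: H.
  exact: H.
have cd : compact (defect n).
  rewrite defE; apply: compact_closedI; first exact: segment_compact.
  apply: closed_bigI => m _.
  apply: (@preimage_closed _ _ (fun x => smooth_potential c m.+1%:R^-1 mu x - Q x)
     [set t | t <= k - n.+1%:R^-1]).
    by move=> x _; apply: sp_cont; rewrite invr_gt0 ltr0n.
  exact: closed_le.
apply/negligibleP; first exact: compact_measurable.
apply: (quasi_everywhere_null equil cd) => x [xa H]; first by rewrite /= in_itv.
move=> /oppeD_eq Ux.
have : (green_potential c mu x <= (k - n.+1%:R^-1 + Q x)%:E)%E.
  have cv : (smooth_potential c m.+1%:R^-1 mu x)%:E @[m --> \oo] -->
      green_potential c mu x by exact: (smooth_potential_cvg c_gt0 mu_mass).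
  rewrite -(cvg_lim _ cv)//; apply: lime_le; first by apply/cvg_ex; eexists; exact: cv.
  by apply: nearW => m; rewrite lee_fin -lerBlDr; exact: H.
have : 0 < n.+1%:R^-1 :> R by rewrite invr_gt0 ltr0n.
by rewrite Ux lee_fin; move: n.+1%:R^-1 => i; lra.
Qed.

(* Off a null set the inequality is the hypothesis; averaging over small
   intervals recovers it at every point. *)
Lemma green_potential_ge_equilibrium (x : R) : ((k + Q x)%:E <= green_potential c mu x)%E.
Proof.
(* The finite mass lets [mu] be repackaged as a finite measure, the structure required by the
   averaging lemma. *)
have fin : fin_num_fun mu.
  move=> A mA; rewrite ge0_fin_numE//; apply: (@le_lt_trans _ _ (mu setT)).
    by apply: le_measure; rewrite ?inE.
  by rewrite mu_mass ltry.
have sigma : sigma_finite setT mu.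
  by apply: fin_num_fun_sigma_finite; [rewrite measure0|].
pose H1 := isFinite.Build _ _ _ (Measure.sort mu) fin.
pose H2 := isSFinite.Build _ _ _ (Measure.sort mu) (sfinite_measure_sigma_finite sigma).
pose H3 := isSigmaFinite.Build _ _ _ (Measure.sort mu) sigma.
pose mu' := HB.pack_for (FiniteMeasure.type (measurableTypeR R) R) (Measure.sort mu) H1 H2 H3.
(* The margin [eta] absorbs the variation of [Q] near [x]. *)
apply/lee_addgt0Pr => eta eta0; rewrite -leeBlDr// -EFinB.
have : \forall y \near x, Q x - eta < Q y.
  by apply: (cvgr_gt _ (@Q_cont x)); lra.
move=> /nbhs_ballP[r /= r0 rQ].
have r20 : 0 < r / 2 by rewrite divr_gt0.
apply: (@green_potential_ge_ae _ c c_gt0 mu' x (r / 2) (k + Q x - eta)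
  (\bigcup_n defect n) r20).
  by apply: negligible_bigcup => n; exact: defect_null.
move=> y xy Ny; apply: (@le_trans _ _ (k + Q y)%:E).
  have /rQ /= : ball x r y by rewrite /ball /= distrC; lra.
  by rewrite lee_fin; lra.
have [ya|/negP ya] := boolP (- a <= y <= a); last first.
  by rewrite -oppeD_le; apply: outside; rewrite /= in_itv.
rewrite leNgt; apply/negP => lt; apply: Ny.
have Ufin : green_potential c mu' y \is a fin_num.
  rewrite ge0_fin_numE ?(lt_trans lt) ?ltry//.
  exact: green_potential_ge0.
pose U := fine (green_potential c mu' y).
have UE : green_potential c mu' y = U%:E by rewrite fineK.
move: lt; rewrite UE lte_fin => lt.
have gap : 0 < k + Q y - U by rewrite subr_gt0.
have [n _ /(_ n (leqnn n)) /= Hn] := near_invS_le gap.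
exists n => //; split => // m.
have m0 : 0 < m.+1%:R^-1 :> R by rewrite invr_gt0 ltr0n.
have := smooth_potential_le_green c_gt0 mu_mass m0 y.
have -> : green_potential c mu y = U%:E by exact: UE.
by rewrite lee_fin; move: Hn; move: n.+1%:R^-1 => i; lra.
Qed.

End Equilibrium.

(** * Optimality of the equilibrium pair *)

Unset Implicit Arguments.

Theorem theorem3p2 (R : realType) (d : R) (N : nat) (w : R[i] -> R[i])
    (alphaN : R) (muN : {measure set (measurableTypeR R) -> \bar R})
    (d_gt0 : 0 < d) (N_gt0 : (0 < N)%N) (w_weight : weight_function d w)
    (alphaN_gt0 : 0 < alphaN)
    (muN_mass : muN [set: R] = (2 * N.+1)%:R%:E)
    (muN_supp : measure_support muN = `[- alphaN, alphaN]%classic)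
    (muN_equil : exists KN : R,
      quasi_everywhere `[- alphaN, alphaN]%classic
        (fun x => (potential d muN x + (logw w x)%:E)%E = (- KN)%:E) /\
      (forall x : R, ~ `[- alphaN, alphaN]%classic x ->
         (potential d muN x + (logw w x)%:E <= (- KN)%:E)%E)) :
  is_solution d w (2 * N.+1)%:R (alphaN, muN).
Proof.
have [KN [qe out]] := muN_equil.
set M : R := (2 * N.+1)%:R in muN_mass *.
pose c : R := pi / (4 * d).
have c0 : 0 < c by rewrite divr_gt0 ?pi_gt0 ?mulr_gt0.
have potE mu x : potential d mu x = (- green_potential c mu x)%E by exact: potentialE.
have Q_cont : continuous (logw w) := logw_continuous d_gt0 w_weight.
have qe' : quasi_everywhere `[- alphaN, alphaN]%classic
    (fun x => (- green_potential c muN x + (logw w x)%:E)%E = (- KN)%:E).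
  rewrite -(_ : (fun x => (potential d muN x + (logw w x)%:E)%E = (- KN)%:E) =
    (fun x => (- green_potential c muN x + (logw w x)%:E)%E = (- KN)%:E)) //.
  by apply/funext => x; rewrite potE.
have out' x : ~ `[- alphaN, alphaN]%classic x ->
    (- green_potential c muN x + (logw w x)%:E <= (- KN)%:E)%E.
  by rewrite -potE; exact: out.
have objN : (objective d w muN <= (- KN)%:E)%E.
  apply: ge_ereal_sup => _ [x _ <-]; rewrite potE oppeD_le.
  exact: (green_potential_ge_equilibrium c0 muN_mass Q_cont qe' out').
have admN : admissible M (alphaN, muN) by [].
split=> //; apply/eqP; rewrite eq_le; apply/andP; split; last first.
  by apply: ereal_inf_lbound; exists (alphaN, muN).
apply: le_trans objN _; apply: le_ereal_inf_tmp => _ [[a mu] [_ mu_mass _] <-] /=.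
rewrite leNgt; apply/negP => lt.
(* A real bound is chosen because the competing objective could be [-oo]. *)
have [r rK le_r] : exists2 r : R, r < - KN & (objective d w mu <= r%:E)%E.
  case: (objective d w mu) lt => [r||] //; first by rewrite lte_fin; exists r.
  by exists (- KN - 1); [rewrite gtrBl|rewrite leNye].
pose eps : R := - KN - r.
have eps0 : 0 < eps by rewrite subr_gt0.
have U_ge x : ((KN + logw w x + eps)%:E <= green_potential c mu x)%E.
  have : (potential d mu x + (logw w x)%:E <= r%:E)%E.
    by apply: le_trans le_r; apply: ereal_sup_ubound; exists x.
  rewrite potE -[r]opprK oppeD_le; congr (_%:E <= _)%E.
  by rewrite /eps; ring.
have g_cont : continuous (fun x : R => KN + logw w x + eps / 2).
  move=> x; apply: cvgD; last exact: cvg_cst.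
  by apply: cvgD; [exact: cvg_cst|exact: Q_cont].
(* Half of [eps] is given up to replace the potential of [mu] by one smoothed potential, uniformly
   on the interval. *)
have [n||n Hn] := @nondecreasing_cover R `[- alphaN, alphaN]%classic
   (fun n => smooth_potential c n.+1%:R^-1 mu) (fun x => KN + logw w x + eps / 2)
   (@segment_compact _ _ _) _ g_cont (smooth_potential_nondecreasing c0 mu_mass) _.
- by apply: (smooth_potential_continuous c0 mu_mass).
- move=> x _; apply: contrapT => /forallNP nx.
  have cv : (smooth_potential c m.+1%:R^-1 mu x)%:E @[m --> \oo] -->
      green_potential c mu x by exact: (smooth_potential_cvg c0 mu_mass).
  have : (green_potential c mu x <= (KN + logw w x + eps / 2)%:E)%E.
    rewrite -(cvg_lim _ cv)//; apply: lime_le; first by apply/cvg_ex; eexists; exact: cv.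
    by apply: nearW => m; rewrite lee_fin leNgt; apply/negP/nx.
  move=> /(le_trans (U_ge x)); rewrite lee_fin lerD2l.
  by apply/negP; rewrite -ltNge; lra.
have n0 : 0 < n.+1%:R^-1 :> R by rewrite invr_gt0 ltr0n.
have eps20 : 0 < eps / 2 by rewrite divr_gt0.
(* At this smoothing level the potential of [muN] is at most [KN + logw w] on the interval, and that
   of [mu] exceeds this by more than [eps / 2]. *)
apply: (smooth_potential_not_dominated c0 alphaN_gt0 n0 eps20 mu_mass muN_mass).
  by rewrite -muN_supp; exact: measure_support_setC.
move=> x xa.
have := smooth_potential_le_equilibrium c0 muN_mass alphaN_gt0 Q_cont qe' n0 xa.
have := Hn x; rewrite /= in_itv/= xa => /(_ isT).
by move: (smooth_potential _ _ _ _) (smooth_potential _ _ _ _) => p q; lra.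
Qed.
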